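(* Let $(\Omega,\mathbb P)$ be a probability space carrying a sequence $(s_n)_{n\in\mathbb N}$ of i.i.d. Steinhaus random variables, let $X=Y=\operatorname{MIN}(L^\infty(\Omega,\mathbb P))$, and let $Z=\overline{\operatorname{span}}(s_n)_{n\in\mathbb N}\subset L^\infty(\Omega,\mathbb P)$ (norm closure), regarded as a common subspace of $X$ and $Y$ via the inclusion. Then the amalgamated $\ell_\infty$-direct sum $(X\oplus_Z Y)_\infty$ is not completely isomorphic to a minimal operator space.
   Context: All spaces are complex. A Steinhaus random variable is one uniformly distributed on the unit circle $\{|z|=1\}\subset\mathbb C$. An operator space $X$ is minimal if for every operator space $Y$ every contraction $T:Y\to X$ is a complete contraction. For a Banach space $E$, $\operatorname{MIN}(E)$ denotes $E$ with its (unique) minimal operator space structure. The $\ell_\infty$-direct sum $X\oplus_\infty Y$ has matrix norms $\|(x,y)\|_{M_n(X\oplus_\infty Y)}=\max(\|x\|_{M_n(X)},\|y\|_{M_n(Y)})$. If $Z$ is a common subspace of $X$ and $Y$ (i.e. complete isometries $Z\hookrightarrow X$, $Z\hookrightarrow Y$ are given), the amalgamated $\ell_\infty$-direct sum is the quotient operator space $(X\oplus_Z Y)_\infty:=(X\oplus_\infty Y)/\overline{\operatorname{span}}\{(z,-z):z\in Z\}$. Two operator spaces are completely isomorphic if there is a linear bijection between them that is completely bounded with completely bounded inverse. *)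

(* Defs.v *)
From HB Require Import structures.
From mathcomp Require Import all_boot all_order all_algebra.
From mathcomp Require Import generic_quotient ring_quotient complex ring lra.
From mathcomp Require Import all_classical all_reals all_analysis.
From mathcomp Require Import ess_sup_inf measurable_realfun.

Set Implicit Arguments.
Unset Strict Implicit.
Unset Printing Implicit Defensive.

Import Order.TTheory GRing.Theory Num.Theory.
Import numFieldNormedType.Exports.
Import ComplexField.Normc.

Local Open Scope classical_set_scope.
Local Open Scope ring_scope.
Local Open Scope complex_scope.

Section Submodules.
Variables (K : nzRingType) (V : lmodType K).

Record submodule := Submodule {
  submod_pred :> {pred V};
  submod_predP : submod_closed submod_pred }.

HB.instance Definition _ (W : submodule) :=
  GRing.isSubmodClosed.Build K V (submod_pred W) (submod_predP W).

Definition lspan (A : set V) : set V :=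
  [set v | exists n (c : 'I_n -> K) (a : 'I_n -> V),
     (forall i, A (a i)) /\ v = \sum_i c i *: a i].

Variable W : submodule.

Definition submod_type : Type := {v : V | v \in submod_pred W}.
HB.instance Definition _ := SubType.on submod_type.
HB.instance Definition _ := [Choice of submod_type by <:].
HB.instance Definition _ := [SubChoice_isSubLmodule of submod_type by <:].

Lemma submod_valP c (u v : submod_type) :
  \val (c *: u + v) = c *: \val u + \val v.
Proof. by []. Qed.

Lemma submod_valZ c (u : submod_type) : \val (c *: u) = c *: \val u.
Proof. by []. Qed.

Lemma submod_valD (u v : submod_type) : \val (u + v) = \val u + \val v.
Proof. by []. Qed.

Lemma submod_valB (u v : submod_type) : \val (u - v) = \val u - \val v.
Proof. by []. Qed.

Definition lquot : Type := Quotient.quot (submod_pred W).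
HB.instance Definition _ := GRing.Zmodule.on lquot.
HB.instance Definition _ := Quotient.on lquot.

Definition lquot_pi (v : V) : lquot := \pi_lquot%qT v.

Lemma lquot_eq u v : lquot_pi u = lquot_pi v <-> u - v \in submod_pred W.
Proof.
rewrite (Quotient.idealrBE (submod_pred W)); split; first by move/eqP.
by move/eqP.
Qed.

Lemma lquot_piK (q : lquot) : lquot_pi (repr q) = q.
Proof. exact: reprK. Qed.

Lemma lquot_piD u v : lquot_pi (u + v) = lquot_pi u + lquot_pi v.
Proof. exact: (Quotient.pi_add (submod_pred W)). Qed.

Definition lquot_scale (c : K) (q : lquot) : lquot := lquot_pi (c *: repr q).

Lemma lquot_piZ c v : lquot_pi (c *: v) = lquot_scale c (lquot_pi v).
Proof.
apply/lquot_eq; rewrite -scalerBr rpredZ//.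
by apply/lquot_eq; rewrite lquot_piK.
Qed.

Lemma lquot_scaleA a b q : lquot_scale a (lquot_scale b q) = lquot_scale (a * b) q.
Proof. by rewrite -(lquot_piK q) -!lquot_piZ scalerA. Qed.

Lemma lquot_scale1 : left_id 1 lquot_scale.
Proof. by move=> q; rewrite -(lquot_piK q) -!lquot_piZ scale1r. Qed.

Lemma lquot_scaleDr : right_distributive lquot_scale +%R.
Proof.
move=> a p q; rewrite -(lquot_piK p) -(lquot_piK q) -lquot_piD -!lquot_piZ.
by rewrite scalerDr lquot_piD.
Qed.

Lemma lquot_scaleDl q : {morph lquot_scale^~ q : a b / a + b}.
Proof.
by move=> a b; rewrite -(lquot_piK q) -!lquot_piZ scalerDl lquot_piD.
Qed.

HB.instance Definition _ := GRing.Zmodule_isLmodule.Build K lquot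
  lquot_scaleA lquot_scale1 lquot_scaleDr lquot_scaleDl.

Lemma lquot_pi_is_linear : linear lquot_pi.
Proof. by move=> c u v; rewrite lquot_piD lquot_piZ. Qed.

HB.instance Definition _ :=
  GRing.isLinear.Build K V lquot *:%R lquot_pi lquot_pi_is_linear.
End Submodules.

Section L2.
Variable R : realType.
Local Notation C := R[i].

Definition l2norm m n (A : 'M[C]_(m, n)) : R :=
  Num.sqrt (\sum_i \sum_j normc (A i j) ^+ 2).

(* Norm of A as an operator from l^2_n to l^2_m. *)
Definition opnorm m n (A : 'M[C]_(m, n)) : R :=
  sup [set l2norm (A *m v) | v in [set v : 'cV[C]_n | l2norm v <= 1]].

Lemma normc_ge0 (z : C) : 0 <= normc z.
Proof. by case: z => a b; rewrite sqrtr_ge0. Qed.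

Lemma normc_sum (I : Type) (r : seq I) (F : I -> C) :
  normc (\sum_(i <- r) F i) <= \sum_(i <- r) normc (F i).
Proof.
elim: r => [|i r IH]; first by rewrite !big_nil normc0.
by rewrite !big_cons; apply: le_trans (le_normcD _ _) _; rewrite lerD2l.
Qed.

Lemma normr_normc (z : C) : `|z| = (normc z)%:C.
Proof. by []. Qed.

Lemma l2_sum_ge0 m n (A : 'M[C]_(m, n)) : 0 <= \sum_i \sum_j normc (A i j) ^+ 2.
Proof. by do 2 apply: sumr_ge0 => ? _; rewrite exprn_ge0// normc_ge0. Qed.

Lemma l2norm_ge0 m n (A : 'M[C]_(m, n)) : 0 <= l2norm A.
Proof. exact: sqrtr_ge0. Qed.

Lemma sqr_l2norm m n (A : 'M[C]_(m, n)) :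
  l2norm A ^+ 2 = \sum_i \sum_j normc (A i j) ^+ 2.
Proof. by rewrite sqr_sqrtr// l2_sum_ge0. Qed.

Lemma l2norm_le m n (A : 'M[C]_(m, n)) (x : R) : 0 <= x ->
  \sum_i \sum_j normc (A i j) ^+ 2 <= x ^+ 2 -> l2norm A <= x.
Proof.
by move=> x0 h; rewrite -(@ler_pXn2r _ 2) ?nnegrE ?l2norm_ge0// sqr_l2norm.
Qed.

Lemma cauchy_schwarz (I : finType) (f g : I -> R) :
  (\sum_i f i * g i) ^+ 2 <= (\sum_i f i ^+ 2) * (\sum_i g i ^+ 2).
Proof.
set A := \sum_i f i ^+ 2; set B := \sum_i g i ^+ 2; set S := \sum_i f i * g i.
have A0 : 0 <= A by apply: sumr_ge0 => i _; rewrite sqr_ge0.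
have [A00|An0] := eqVneq A 0.
  have f0 i : f i = 0.
    apply/eqP; rewrite -sqrf_eq0; apply/eqP.
    by apply: (psumr_eq0P _ A00) => // j _; rewrite sqr_ge0.
  rewrite /S big1 ?A00; first by rewrite expr0n mul0r.
  by move=> i _; rewrite f0 mul0r.
have : 0 <= \sum_i (A * g i - S * f i) ^+ 2.
  by apply: sumr_ge0 => i _; rewrite sqr_ge0.
rewrite (_ : \sum_i _ = A * (A * B - S ^+ 2)).
  by rewrite pmulr_rge0 ?subr_ge0// lt_def An0.
transitivity (\sum_i (A ^+ 2 * g i ^+ 2 + S ^+ 2 * f i ^+ 2
                      - A * S *+ 2 * (f i * g i))).
  by apply: eq_bigr => i _; ring.
rewrite sumrB big_split/= -!mulr_sumr -/A -/B -/S; ring.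
Qed.

Lemma l2norm_mul m n p (A : 'M[C]_(m, n)) (B : 'M[C]_(n, p)) :
  l2norm (A *m B) <= l2norm A * l2norm B.
Proof.
apply: l2norm_le; first by rewrite mulr_ge0// l2norm_ge0.
rewrite exprMn !sqr_l2norm [X in _ * X]exchange_big/= big_distrlr/=.
apply: ler_sum => i _; apply: ler_sum => j _; rewrite mxE.
apply: le_trans (cauchy_schwarz _ _).
rewrite ler_pXn2r ?nnegrE ?normc_ge0//; last first.
  by apply: sumr_ge0 => k _; rewrite mulr_ge0// normc_ge0.
apply: le_trans (normc_sum _ _) _.
by apply: ler_sum => k _; rewrite normcM.
Qed.

Lemma l2normZ m n c (A : 'M[C]_(m, n)) : l2norm (c *: A) = normc c * l2norm A.
Proof.
rewrite /l2norm -[normc c](@ger0_norm _ (normc c)) ?normc_ge0//.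
rewrite -sqrtr_sqr -sqrtrM ?sqr_ge0// mulr_sumr; congr Num.sqrt.
apply: eq_bigr => i _; rewrite mulr_sumr; apply: eq_bigr => j _.
by rewrite mxE normcM exprMn.
Qed.

Lemma l2norm0 m n : l2norm (0 : 'M[C]_(m, n)) = 0.
Proof.
rewrite /l2norm big1 ?sqrtr0// => i _; rewrite big1// => j _.
by rewrite mxE normc0 expr0n.
Qed.

Lemma l2norm_eq0 m n (A : 'M[C]_(m, n)) : l2norm A = 0 -> A = 0.
Proof.
move=> A0; have := sqr_l2norm A; rewrite A0 expr0n/= => /esym h.
apply/matrixP => i j; rewrite mxE; apply: eq0_normc; apply/eqP.
rewrite -sqrf_eq0; apply/eqP.
have h1 : \sum_j normc (A i j) ^+ 2 = 0.
  apply: (psumr_eq0P _ h) => // k _.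
  by apply: sumr_ge0 => ? _; rewrite exprn_ge0// normc_ge0.
by apply: (psumr_eq0P _ h1) => // k _; rewrite exprn_ge0// normc_ge0.
Qed.

Let opset m n (A : 'M[C]_(m, n)) :=
  [set l2norm (A *m v) | v in [set v : 'cV[C]_n | l2norm v <= 1]].

Let opset_sup m n (A : 'M[C]_(m, n)) : has_sup (opset A).
Proof.
split.
  by exists 0, 0; rewrite /= ?mulmx0 ?l2norm0// ler01.
exists (l2norm A) => _ [v /= v1 <-]; apply: le_trans (l2norm_mul _ _) _.
by rewrite ler_piMr// l2norm_ge0.
Qed.

Lemma opnorm_ge0 m n (A : 'M[C]_(m, n)) : 0 <= opnorm A.
Proof.
apply: (@sup_upper_bound _ (opset A)); first exact: opset_sup.
by exists 0; rewrite /= ?mulmx0 ?l2norm0// ler01.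
Qed.

Lemma opnorm_le m n (A : 'M[C]_(m, n)) x :
  0 <= x -> (forall v : 'cV_n, l2norm (A *m v) <= x * l2norm v) -> opnorm A <= x.
Proof.
move=> x0 h; apply: ge_sup; first by have [] := opset_sup A.
move=> _ [v /= v1 <-]; apply: le_trans (h v) _.
by rewrite ler_piMr.
Qed.

Lemma opnorm_le_l2 m n (A : 'M[C]_(m, n)) : opnorm A <= l2norm A.
Proof. by apply: opnorm_le => [|v]; rewrite ?l2norm_ge0// l2norm_mul. Qed.

Lemma l2norm_mulv m n (A : 'M[C]_(m, n)) (v : 'cV_n) :
  l2norm (A *m v) <= opnorm A * l2norm v.
Proof.
have [v0|vn0] := eqVneq (l2norm v) 0.
  by rewrite v0 mulr0 (l2norm_eq0 v0) mulmx0 l2norm0.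
have vp : 0 < l2norm v by rewrite lt_def vn0 l2norm_ge0.
have nc : normc ((l2norm v)^-1)%:C = (l2norm v)^-1.
  by rewrite /= expr0n addr0 sqrtr_sqr ger0_norm// invr_ge0 ltW.
rewrite -ler_pdivrMr// mulrC -nc -l2normZ scalemxAr.
apply: (@sup_upper_bound _ (opset A)); first exact: opset_sup.
exists ((l2norm v)^-1%:C *: v) => //=.
by rewrite l2normZ nc mulVf.
Qed.

Lemma l2norm_conj n (w : 'rV[C]_n) : exists ws : 'cV[C]_n,
  l2norm ws = l2norm w /\ l2norm (w *m ws) = l2norm w ^+ 2.
Proof.
pose ws : 'cV[C]_n := \col_j (w ord0 j)^*.
have nwc (z : C) : normc z^* = normc z by case: z => a b /=; rewrite sqrrN.
exists ws; split.
  rewrite /l2norm exchange_big/=; congr Num.sqrt.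
  by apply: eq_bigr => i _; apply: eq_bigr => j _; rewrite mxE (ord1 i) nwc.
have e : w *m ws = ((l2norm w) ^+ 2)%:C%:M.
  apply/matrixP => i j; rewrite !ord1 !mxE eqxx mulr1n sqr_l2norm big_ord1.
  rewrite rmorph_sum/=; apply: eq_bigr => k _; rewrite mxE.
  case: (w ord0 k) => a b; rewrite /= sqr_sqrtr ?addr_ge0 ?sqr_ge0//.
  by apply/eqP; rewrite eq_complex/=; apply/andP; split; apply/eqP; ring.
rewrite e /l2norm !big_ord1 !mxE eqxx mulr1n -/(l2norm w) sqrtr_sqr.
by rewrite ger0_norm ?normc_ge0//= expr0n addr0 sqrtr_sqr ger0_norm// sqr_ge0.
Qed.

Lemma l2norm_mulrv m n (A : 'M[C]_(m, n)) (u : 'rV_m) :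
  l2norm (u *m A) <= opnorm A * l2norm u.
Proof.
set w := u *m A.
have [w0|wn0] := eqVneq (l2norm w) 0.
  by rewrite w0 mulr_ge0 ?opnorm_ge0 ?l2norm_ge0.
have wp : 0 < l2norm w by rewrite lt_def wn0 l2norm_ge0.
have [ws [l2ws l2e]] := l2norm_conj w.
rewrite -(ler_pM2r wp) -expr2 -l2e -mulmxA.
apply: le_trans (l2norm_mul _ _) _.
rewrite mulrC -mulrA [_ * l2norm w]mulrC mulrA ler_wpM2r ?l2norm_ge0//.
by rewrite -l2ws l2norm_mulv.
Qed.

Lemma l2norm_delta m n (i : 'I_m) (j : 'I_n) :
  l2norm (delta_mx i j : 'M[C]_(m, n)) <= 1.
Proof.
have dij : delta_mx i j i j = 1 :> C by rewrite mxE !eqxx.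
have d0 k l : (k != i) || (l != j) -> delta_mx i j k l = 0 :> C.
  by rewrite mxE -negb_and => /negPf ->.
apply: l2norm_le => //.
rewrite (bigD1 i)//= (bigD1 j)//= dij normc1 !big1 ?addr0//.
- by move=> k ki; rewrite big1// => l _; rewrite d0 ?ki// normc0 expr0n.
- by move=> l lj; rewrite d0 ?lj ?orbT// normc0 expr0n.
Qed.

Lemma opnorm_delta m n (i : 'I_m) (j : 'I_n) :
  opnorm (delta_mx i j : 'M[C]_(m, n)) <= 1.
Proof. exact: le_trans (opnorm_le_l2 _) (l2norm_delta _ _). Qed.

Lemma opnorm_row_proj m n :
  opnorm (row_mx 1%:M 0 : 'M[C]_(m, m + n)) <= 1 /\
  opnorm (row_mx 0 1%:M : 'M[C]_(n, m + n)) <= 1.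
Proof.
have key (v : 'cV[C]_(m + n)) :
    l2norm v ^+ 2 = l2norm (usubmx v) ^+ 2 + l2norm (dsubmx v) ^+ 2.
  rewrite !sqr_l2norm big_split_ord/=; congr (_ + _);
  by apply: eq_bigr => i _; apply: eq_bigr => j _; rewrite mxE.
split; apply: opnorm_le => // v; rewrite mul1r.
  rewrite -{1}(vsubmxK v) mul_row_col mul1mx mul0mx addr0.
  apply: l2norm_le; rewrite ?l2norm_ge0// -sqr_l2norm key.
  by rewrite lerDl sqr_ge0.
rewrite -{1}(vsubmxK v) mul_row_col mul1mx mul0mx add0r.
apply: l2norm_le; rewrite ?l2norm_ge0// -sqr_l2norm key.
by rewrite lerDr sqr_ge0.
Qed.

Lemma opnorm_col_proj m n :
  opnorm (col_mx 1%:M 0 : 'M[C]_(m + n, m)) <= 1 /\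
  opnorm (col_mx 0 1%:M : 'M[C]_(m + n, n)) <= 1.
Proof.
split; apply: opnorm_le => // v; rewrite mul1r mul_col_mx mul1mx mul0mx;
  apply: l2norm_le; rewrite ?l2norm_ge0// big_split_ord/=.
  rewrite [X in _ + X]big1 ?addr0 => [|i _]; last first.
    by rewrite big1// => j _; rewrite col_mxEd mxE normc0 expr0n.
  rewrite sqr_l2norm ler_sum// => i _.
  by rewrite ler_sum// => j _; rewrite col_mxEu.
rewrite [X in X + _]big1 ?add0r => [|i _]; last first.
  by rewrite big1// => j _; rewrite col_mxEu mxE normc0 expr0n.
rewrite sqr_l2norm ler_sum// => i _.
by rewrite ler_sum// => j _; rewrite col_mxEd.
Qed.

End L2.

Lemma ltr0C (R : realType) (x : R) : (0 < x%:C :> R[i]) = (0 < x).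
Proof. by rewrite ltcE/= eqxx. Qed.

Section RNorm.
Variables (R : realType) (V : normedModType R[i]).

(* The norm of a normedModType over R[i] is itself R[i]-valued. *)
Definition rnorm (x : V) : R := complex.Re `|x|.

Lemma rnormE x : (rnorm x)%:C = `|x|.
Proof. by rewrite /rnorm RRe_real// ger0_real. Qed.

Lemma rnorm_ge0 x : 0 <= rnorm x.
Proof. by rewrite -ler0c rnormE. Qed.

Lemma rnormD x y : rnorm (x + y) <= rnorm x + rnorm y.
Proof. by rewrite -lecR rmorphD/= !rnormE ler_normD. Qed.

Lemma rnormZ c x : rnorm (c *: x) = normc c * rnorm x.
Proof. by apply: complexI; rewrite rmorphM/= !rnormE normrZ. Qed.

Lemma rnorm0_eq0 x : rnorm x = 0 -> x = 0.
Proof. by move=> x0; apply/eqP; rewrite -normr_eq0 -rnormE x0. Qed.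

Lemma rnorm0 : rnorm 0 = 0.
Proof. by rewrite /rnorm normr0. Qed.

Lemma rnorm_sum (I : Type) (r : seq I) (F : I -> V) :
  rnorm (\sum_(i <- r) F i) <= \sum_(i <- r) rnorm (F i).
Proof.
elim: r => [|i r IH]; first by rewrite !big_nil rnorm0.
by rewrite !big_cons; apply: le_trans (rnormD _ _) _; rewrite lerD2l.
Qed.
End RNorm.

Section ClosedSubmodules.
Variables (R : realType) (V : normedModType R[i]).

Record closed_submodule := ClosedSubmodule {
  csubmod :> submodule V;
  csubmod_closed : closed [set x | x \in csubmod] }.

Lemma submod_rnormP (W : submodule V) (x : V) :
  closure [set x | x \in W] x <->
  forall e : R, 0 < e -> exists2 y, y \in W & rnorm (x - y) < e.
Proof.
split=> [clx e e0|h].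
  have [|y [/= yW]] := clx (ball x e%:C).
    by apply: nbhsx_ballx; rewrite ltr0C.
  by rewrite -ball_normE/= -rnormE ltcR => ?; exists y.
move=> B /nbhs_ballP[e /= e0 eB].
have e_real : (complex.Re e)%:C = e by rewrite RRe_real// gtr0_real.
have [|y yW xy] := h (complex.Re e); first by rewrite -ltr0C e_real.
by exists y; split => //; apply: eB; rewrite -ball_normE/= -rnormE -e_real ltcR.
Qed.

Lemma lspan_closed_subproof (A : set V) :
  submod_closed [pred v : V | `[< lspan A v >]].
Proof.
have inP v : (v \in [pred v : V | `[< lspan A v >]]) = `[< lspan A v >] by [].
split=> [|c u v]; rewrite !inP.
  apply/asboolP; rewrite /lspan/=; exists 0%N, (fun=> 0), (fun=> 0); split; first by case.
  by rewrite big_ord0.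
move=> /asboolP[n [a [x [Ax ->]]]] /asboolP[m [b [y [Ay ->]]]].
apply/asboolP; rewrite /lspan/=.
exists (n + m)%N,
  (fun i => match fintype.split i with inl j => c * a j | inr k => b k end),
  (fun i => match fintype.split i with inl j => x j | inr k => y k end).
split; first by move=> i; case: fintype.split.
rewrite big_split_ord/= scaler_sumr; congr (_ + _); apply: eq_bigr => i _.
  by rewrite (unsplitK (inl i)) scalerA.
by rewrite (unsplitK (inr i)).
Qed.

Definition lspan_submod (A : set V) := Submodule (lspan_closed_subproof A).

Lemma clspan_submod_subproof (A : set V) :
  submod_closed [pred v : V | `[< closure (lspan A) v >]].
Proof.
have spanE : lspan A = [set x | x \in lspan_submod A].
  by apply/seteqP; split => x /asboolP.
have clP v : reflect
    (forall e : R, 0 < e -> exists2 y, y \in lspan_submod A & rnorm (v - y) < e)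
    (v \in [pred v : V | `[< closure (lspan A) v >]]).
  by rewrite -[_ \in _]/`[< _ >] spanE; apply: (iffP (asboolP _)) => /submod_rnormP.
split=> [|c u v].
  by apply/clP => e e0; exists 0; rewrite ?rpred0// subr0 rnorm0.
move=> /clP hu /clP hv; apply/clP => e e0.
have c1 : 0 < normc c + 1 by rewrite ltr_wpDl ?normc_ge0.
have [|x xA ux] := hu (e / 2 / (normc c + 1)); first by rewrite !divr_gt0.
have [|y yA vy] := hv (e / 2); first by rewrite divr_gt0.
exists (c *: x + y); first by rewrite rpredD ?rpredZ.
rewrite opprD addrACA -scalerBr; apply: le_lt_trans (rnormD _ _) _.
rewrite [e]splitr ler_ltD// rnormZ.
rewrite ltr_pdivlMr// in ux; apply: le_trans (ltW ux).
by rewrite mulrC ler_wpM2l ?rnorm_ge0// lerDl.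
Qed.

Lemma clspan_closed_subproof (A : set V) :
  closed [set x | x \in Submodule (clspan_submod_subproof A)].
Proof.
rewrite (_ : [set _ | _] = closure (lspan A)); first exact: closed_closure.
by apply/seteqP; split => x /asboolP.
Qed.

Definition clspan (A : set V) : closed_submodule :=
  ClosedSubmodule (clspan_closed_subproof (A := A)).

End ClosedSubmodules.

Section SubNormed.
Variables (R : realType) (V : normedModType R[i]) (W : closed_submodule V).

Definition csubmod_type : Type := submod_type W.
HB.instance Definition _ := GRing.Lmodule.on csubmod_type.

Definition csubmod_val (w : csubmod_type) : V := \val (w : submod_type W).

Lemma csubmod_val_is_linear : linear csubmod_val.
Proof. by []. Qed.

HB.instance Definition _ := GRing.isLinear.Build R[i] csubmod_type V *:%R
  csubmod_val csubmod_val_is_linear.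

Let sub_norm (w : csubmod_type) : R[i] := `|csubmod_val w|.

Let sub_normD x y : sub_norm (x + y) <= sub_norm x + sub_norm y.
Proof. by rewrite /sub_norm linearD ler_normD. Qed.

Let sub_normZ c x : sub_norm (c *: x) = `|c| * sub_norm x.
Proof. by rewrite /sub_norm linearZ normrZ. Qed.

Let sub_norm0_eq0 x : sub_norm x = 0 -> x = 0.
Proof.
move=> /eqP; rewrite normr_eq0 => /eqP x0; apply: val_inj.
by rewrite [LHS]x0.
Qed.

HB.instance Definition _ := Lmodule_isNormed.Build R[i] csubmod_type
  sub_normD sub_normZ sub_norm0_eq0.

Lemma csubmod_normE (w : csubmod_type) : `|w| = `|csubmod_val w|.
Proof. by []. Qed.
End SubNormed.

(* Quotient (semi)norms, used both for vectors and for matrices of vectors. *)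
Section InfNorm.
Variables (R : realType) (U Q : zmodType) (p : {additive U -> Q}) (N : U -> R).
Hypothesis p_surj : forall q, exists u, p u = q.
Hypothesis N_ge0 : forall u, 0 <= N u.
Hypothesis N_D : forall u v, N (u + v) <= N u + N v.

Definition infnorm (q : Q) : R := inf [set N u | u in [set u | p u = q]].

Lemma infnorm_inf q : has_inf [set N u | u in [set u | p u = q]].
Proof.
split; first by have [u pu] := p_surj q; exists (N u), u.
by exists 0 => _ [u _ <-]; exact: N_ge0.
Qed.

Lemma infnorm_le u : infnorm (p u) <= N u.
Proof. by apply: ge_inf; [have [] := infnorm_inf (p u)|exists u]. Qed.

Lemma infnorm_lt q (e : R) : 0 < e -> exists2 u, p u = q & N u < infnorm q + e.
Proof.
move=> e0; have [_ [u /= pu <-]] := inf_adherent e0 (infnorm_inf q).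
by exists u.
Qed.

Lemma infnorm_ge q (x : R) : (forall u, p u = q -> x <= N u) -> x <= infnorm q.
Proof.
move=> h; apply: lb_le_inf; first by have [] := infnorm_inf q.
by move=> _ [u /= pu <-]; exact: h.
Qed.

Lemma infnorm_ge0 q : 0 <= infnorm q.
Proof. by apply: infnorm_ge => u _. Qed.

Lemma infnormD q r : infnorm (q + r) <= infnorm q + infnorm r.
Proof.
apply/ler_addgt0Pr => e e0.
have e2 : 0 < e / 2 by rewrite divr_gt0.
have [u <- Nu] := infnorm_lt q e2; have [v <- Nv] := infnorm_lt r e2.
rewrite -raddfD; apply: le_trans (infnorm_le _) _; apply: le_trans (N_D _ _) _.
rewrite [e in leRHS]splitr addrACA; apply: lerD; exact: ltW.
Qed.

Lemma infnormZ (s : U -> U) (t : Q -> Q) (c : R) : 0 <= c ->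
  (forall u, p (s u) = t (p u)) -> (forall u, N (s u) <= c * N u) ->
  forall q, infnorm (t q) <= c * infnorm q.
Proof.
move=> c0 pst Ns q; apply/ler_addgt0Pr => e e0.
have c1 : 0 < c + 1 by rewrite ltr_wpDl.
have [|u <- Nu] := infnorm_lt q (e := e / (c + 1)); first by rewrite divr_gt0.
rewrite -pst; apply: le_trans (infnorm_le _) _; apply: le_trans (Ns _) _.
apply: le_trans (ler_wpM2l c0 (ltW Nu)) _.
rewrite mulrDr lerD2l mulrC -mulrA ler_piMr//; first exact: ltW.
by rewrite mulrC ler_pdivrMr// mul1r lerDl.
Qed.
End InfNorm.

Section QuotNormed.
Variables (R : realType) (V : normedModType R[i]) (W : closed_submodule V).

Definition cquot : Type := lquot W.
HB.instance Definition _ := GRing.Lmodule.on cquot.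

Definition cquot_pi : V -> cquot := @lquot_pi _ V W.
HB.instance Definition _ := GRing.Linear.copy cquot_pi (@lquot_pi _ V W).

Lemma cquot_piZ c v : cquot_pi (c *: v) = c *: cquot_pi v.
Proof. exact: (lquot_piZ W). Qed.

Lemma cquot_pi_surj (q : cquot) : exists v, cquot_pi v = q.
Proof. by exists (repr (q : lquot W)); exact: lquot_piK. Qed.

Lemma cquot_pi_eq0 v : cquot_pi v = 0 <-> v \in W.
Proof.
rewrite -(linear0 cquot_pi); split => [/lquot_eq|vW]; first by rewrite subr0.
by apply/lquot_eq; rewrite subr0.
Qed.

Definition cquot_rnorm : cquot -> R := infnorm cquot_pi (@rnorm R V).

Let cquot_norm (q : cquot) : R[i] := (cquot_rnorm q)%:C.

Let rn_ge0 := @rnorm_ge0 R V.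

Let cquot_normD x y : cquot_norm (x + y) <= cquot_norm x + cquot_norm y.
Proof.
rewrite -rmorphD lecR; apply: infnormD => //; [exact: cquot_pi_surj|].
exact: rnormD.
Qed.

Let rn_Zle c q : cquot_rnorm (c *: q) <= normc c * cquot_rnorm q.
Proof.
apply: (@infnormZ _ _ _ _ _ cquot_pi_surj rn_ge0 ( *:%R c)).
- exact: normc_ge0.
- by move=> u; exact: cquot_piZ.
- by move=> u; rewrite rnormZ.
Qed.

Let cquot_normZ c x : cquot_norm (c *: x) = `|c| * cquot_norm x.
Proof.
rewrite normr_normc -rmorphM; congr (_%:C); apply/eqP.
rewrite eq_le rn_Zle/=.
have [->|c0] := eqVneq c 0.
  by rewrite normc0 mul0r (infnorm_ge0 cquot_pi_surj).
have nc : 0 < normc c.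
  rewrite lt_def normc_ge0 andbT; apply: contra c0 => /eqP h.
  by rewrite (eq0_normc h).
rewrite mulrC -ler_pdivlMr// mulrC -normcV -[x in leLHS](scalerK c0).
exact: rn_Zle.
Qed.

Let cquot_norm0_eq0 x : cquot_norm x = 0 -> x = 0.
Proof.
move=> /complexI x0; have [v vx] := cquot_pi_surj x.
rewrite -vx; apply/cquot_pi_eq0.
suff : closure [set y | y \in (W : submodule V)] v.
  by rewrite -(closure_id _).1//; exact: csubmod_closed.
apply/submod_rnormP => e e0.
have [u ux ue] := infnorm_lt cquot_pi_surj rn_ge0 x e0.
exists (v - u); first by apply/cquot_pi_eq0; rewrite linearB/= vx ux subrr.
by rewrite opprB addrC subrK; rewrite -/(cquot_rnorm x) x0 add0r in ue.
Qed.

HB.instance Definition _ := Lmodule_isNormed.Build R[i] cquot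
  cquot_normD cquot_normZ cquot_norm0_eq0.

Lemma cquot_normE (q : cquot) : rnorm q = cquot_rnorm q.
Proof. by []. Qed.
End QuotNormed.

Section MatrixAction.
Variables (R : realType).
Local Notation C := R[i].

(* The product a x b of scalar matrices with a matrix of vectors. *)
Definition mxact (V : lmodType C) m n p q
    (a : 'M[C]_(m, n)) (x : 'M[V]_(n, p)) (b : 'M[C]_(p, q)) : 'M[V]_(m, q) :=
  \matrix_(i, j) \sum_k \sum_l (a i k * b l j) *: x k l.

Lemma mxactA (V : lmodType C) m n n' p' p q (a : 'M[C]_(m, n))
    (a' : 'M[C]_(n, n')) (x : 'M[V]_(n', p')) (b' : 'M[C]_(p', p))
    (b : 'M[C]_(p, q)) :
  mxact a (mxact a' x b') b = mxact (a *m a') x (b' *m b).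
Proof.
apply/matrixP => i j; rewrite !mxE.
transitivity (\sum_k \sum_l \sum_k' \sum_l'
   (a i k * b l j * (a' k k' * b' l' l)) *: x k' l').
  apply: eq_bigr => k _; apply: eq_bigr => l _; rewrite mxE scaler_sumr.
  apply: eq_bigr => k' _; rewrite scaler_sumr; apply: eq_bigr => l' _.
  by rewrite scalerA.
under eq_bigr do rewrite exchange_big/=.
rewrite exchange_big/=; apply: eq_bigr => k' _.
under eq_bigr do rewrite exchange_big/=.
rewrite exchange_big/=; apply: eq_bigr => l' _.
rewrite !mxE big_distrlr/= scaler_suml; apply: eq_bigr => k _.
rewrite scaler_suml; apply: eq_bigr => l _; congr (_ *: _); ring.
Qed.

Lemma map_mxact (V W : lmodType C) (T : {linear V -> W}) m n p q
    (a : 'M[C]_(m, n)) (x : 'M[V]_(n, p)) (b : 'M[C]_(p, q)) :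
  map_mx T (mxact a x b) = mxact a (map_mx T x) b.
Proof.
apply/matrixP => i j; rewrite !mxE linear_sum; apply: eq_bigr => k _.
by rewrite linear_sum; apply: eq_bigr => l _; rewrite linearZ !mxE.
Qed.

Lemma mxactD (V : lmodType C) m n p q (a : 'M[C]_(m, n)) (x y : 'M[V]_(n, p))
    (b : 'M[C]_(p, q)) : mxact a (x + y) b = mxact a x b + mxact a y b.
Proof.
apply/matrixP => i j; rewrite !mxE -big_split; apply: eq_bigr => k _ /=.
by rewrite -big_split; apply: eq_bigr => l _ /=; rewrite mxE scalerDr.
Qed.

Lemma mxact_scale (V : lmodType C) m n p q c d (a : 'M[C]_(m, n))
    (x : 'M[V]_(n, p)) (b : 'M[C]_(p, q)) :
  mxact (c *: a) x (d *: b) = map_mx ( *:%R (c * d)) (mxact a x b).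
Proof.
apply/matrixP => i j; rewrite !mxE scaler_sumr; apply: eq_bigr => k _ /=.
rewrite scaler_sumr; apply: eq_bigr => l _ /=; rewrite !mxE scalerA.
by congr (_ *: _); ring.
Qed.

Lemma mxact_map_scale (V : lmodType C) m n p q c (a : 'M[C]_(m, n))
    (x : 'M[V]_(n, p)) (b : 'M[C]_(p, q)) :
  mxact a (map_mx ( *:%R c) x) b = map_mx ( *:%R c) (mxact a x b).
Proof.
apply/matrixP => i j; rewrite !mxE scaler_sumr; apply: eq_bigr => k _ /=.
rewrite scaler_sumr; apply: eq_bigr => l _ /=; rewrite !mxE !scalerA.
by congr (_ *: _); ring.
Qed.

Lemma mxact_delta (V : lmodType C) n p (x : 'M[V]_(n, p)) k l :
  mxact (delta_mx ord0 k : 'rV_n) x (delta_mx l ord0 : 'cV_p) ord0 ord0 = x k l.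
Proof.
rewrite mxE (bigD1 k)//= (bigD1 l)//= !mxE !eqxx mulr1 scale1r.
rewrite !big1 ?addr0// => [k' kk'|l' ll'].
  by rewrite big1// => l' _; rewrite !mxE (negPf kk') andbF mul0r scale0r.
by rewrite !mxE (negPf ll') mulr0 scale0r.
Qed.

Lemma mxact_blockl (V : lmodType C) m n (x : 'M[V]_m) (y : 'M[V]_n) b c :
  mxact (row_mx 1%:M 0) (block_mx x b c y) (col_mx 1%:M 0) = x.
Proof.
apply/matrixP => i j; rewrite mxE big_split_ord/= [X in _ + X]big1 ?addr0.
  rewrite (bigD1 i)//= [X in _ + X]big1 ?addr0 => [|k ki]; last first.
    by rewrite big1// => l _; rewrite row_mxEl mxE eq_sym (negPf ki) mul0r scale0r.
  rewrite row_mxEl mxE eqxx big_split_ord/= [X in _ + X]big1 ?addr0; last first.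
    by move=> l _; rewrite col_mxEd mxE mulr0 scale0r.
  rewrite (bigD1 j)//= big1 ?addr0 => [|l lj]; last first.
    by rewrite col_mxEu mxE (negPf lj) mulr0 scale0r.
  by rewrite col_mxEu mxE eqxx mulr1 scale1r block_mxEul.
by move=> k _; rewrite big1// => l _; rewrite row_mxEr mxE mul0r scale0r.
Qed.

Lemma mxact_blockr (V : lmodType C) m n (x : 'M[V]_m) (y : 'M[V]_n) b c :
  mxact (row_mx 0 1%:M) (block_mx x b c y) (col_mx 0 1%:M) = y.
Proof.
apply/matrixP => i j; rewrite mxE big_split_ord/= [X in X + _]big1 ?add0r.
  rewrite (bigD1 i)//= [X in _ + X]big1 ?addr0 => [|k ki]; last first.
    by rewrite big1// => l _; rewrite row_mxEr mxE eq_sym (negPf ki) mul0r scale0r.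
  rewrite row_mxEr mxE eqxx big_split_ord/= [X in X + _]big1 ?add0r; last first.
    by move=> l _; rewrite col_mxEu mxE mulr0 scale0r.
  rewrite (bigD1 j)//= big1 ?addr0 => [|l lj]; last first.
    by rewrite col_mxEd mxE (negPf lj) mulr0 scale0r.
  by rewrite col_mxEd mxE eqxx mulr1 scale1r block_mxEdr.
by move=> k _; rewrite big1// => l _; rewrite row_mxEl mxE mul0r scale0r.
Qed.

Lemma mxact_block (V : lmodType C) m n (x : 'M[V]_m) (y : 'M[V]_n)
    (a1 : 'rV[C]_m) (a2 : 'rV[C]_n) (b1 : 'cV[C]_m) (b2 : 'cV[C]_n) :
  mxact (row_mx a1 a2) (block_mx x 0 0 y) (col_mx b1 b2) =
  mxact a1 x b1 + mxact a2 y b2.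
Proof.
apply/matrixP => i j; rewrite !mxE big_split_ord/=; congr (_ + _);
  apply: eq_bigr => k _; rewrite big_split_ord/=.
  rewrite [X in _ + X]big1 ?addr0 => [|l _]; last first.
    by rewrite block_mxEur [X in _ *: X]mxE scaler0.
  by apply: eq_bigr => l _; rewrite row_mxEl col_mxEu block_mxEul.
rewrite [X in X + _]big1 ?add0r => [|l _]; last first.
  by rewrite block_mxEdl [X in _ *: X]mxE scaler0.
by apply: eq_bigr => l _; rewrite row_mxEr col_mxEd block_mxEdr.
Qed.
End MatrixAction.

Section OperatorSpaces.
Variable R : realType.
Local Notation C := R[i].

(* Abstract operator spaces: matrix norms satisfying Ruan's axioms.  The field
   mnorm1 says that the norm on 1 x 1 matrices is the given norm of V. *)
Record opspace (V : normedModType C) := OpSpace {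
  mnorm : forall n, 'M[V]_n -> R;
  mnorm1 : forall x : 'M[V]_1, mnorm x = rnorm (x ord0 ord0);
  mnormD : forall n (x y : 'M[V]_n), mnorm (x + y) <= mnorm x + mnorm y;
  mnormZ : forall n (c : C) (x : 'M[V]_n),
    mnorm (map_mx ( *:%R c) x) = normc c * mnorm x;
  mnorm0_eq0 : forall n (x : 'M[V]_n), mnorm x = 0 -> x = 0;
  mnorm_block : forall m n (x : 'M[V]_m) (y : 'M[V]_n),
    mnorm (block_mx x 0 0 y) = Num.max (mnorm x) (mnorm y);
  mnorm_act : forall m n (a : 'M[C]_(m, n)) (x : 'M[V]_n) (b : 'M[C]_(n, m)),
    mnorm (mxact a x b) <= opnorm a * mnorm x * opnorm b }.

Section Basic.
Variables (V : normedModType C) (O : opspace V).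

Lemma mnorm0 n : mnorm O (0 : 'M[V]_n) = 0.
Proof.
have := mnormZ O 0 (0 : 'M[V]_n); rewrite normc0 mul0r.
by congr (mnorm O _ = _); apply/matrixP => i j; rewrite !mxE scale0r.
Qed.

Lemma mnorm_ge0 n (x : 'M[V]_n) : 0 <= mnorm O x.
Proof.
have := mnormD O x (map_mx ( *:%R (-1)) x); rewrite mnormZ.
have -> : normc (-1 : C) = 1 by rewrite normcN normc1.
rewrite (_ : x + _ = 0); first by rewrite mnorm0 mul1r -mulr2n pmulrn_lge0.
by apply/matrixP => i j; rewrite !mxE scaleN1r subrr.
Qed.

Lemma mnorm_entry n (x : 'M[V]_n) i j : rnorm (x i j) <= mnorm O x.
Proof.
have := mnorm_act O (delta_mx ord0 i : 'rV_n) x (delta_mx j ord0).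
rewrite mnorm1 mxact_delta => /le_trans; apply.
by rewrite mulrAC ler_piMl ?mnorm_ge0// mulr_ile1 ?opnorm_ge0 ?opnorm_delta.
Qed.
End Basic.

Section Maps.
Variables (V W : normedModType C) (OV : opspace V) (OW : opspace W).

Definition contraction (T : V -> W) := forall v, rnorm (T v) <= rnorm v.

Definition complete_contraction (T : V -> W) :=
  forall n (x : 'M[V]_n), mnorm OW (map_mx T x) <= mnorm OV x.

Definition complete_isometry (T : V -> W) :=
  forall n (x : 'M[V]_n), mnorm OW (map_mx T x) = mnorm OV x.

Definition completely_bounded (T : V -> W) :=
  exists M : R, forall n (x : 'M[V]_n), mnorm OW (map_mx T x) <= M * mnorm OV x.
End Maps.

Record cisom_embedding (Z X : normedModType C) (OZ : opspace Z)
    (OX : opspace X) := CIsomEmbedding {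
  ciemb :> {linear Z -> X};
  ciembP : complete_isometry OZ OX ciemb }.

Definition completely_isomorphic (V W : normedModType C)
    (OV : opspace V) (OW : opspace W) :=
  exists (T : {linear V -> W}) (S : {linear W -> V}),
    [/\ cancel T S, cancel S T,
        completely_bounded OV OW T & completely_bounded OW OV S].

Definition minimal_opspace (X : normedModType C) (OX : opspace X) :=
  forall (Y : normedModType C) (OY : opspace Y) (T : {linear Y -> X}),
    contraction T -> complete_contraction OY OX T.

Section Sub.
Variables (V : normedModType C) (O : opspace V) (W : closed_submodule V).

Let sub_mnorm n (x : 'M[csubmod_type W]_n) : R :=
  mnorm O (map_mx (@csubmod_val _ _ W) x).

Let sub1 (x : 'M[csubmod_type W]_1) : sub_mnorm x = rnorm (x ord0 ord0).
Proof. by rewrite /sub_mnorm mnorm1 mxE. Qed.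

Let subD n (x y : 'M[csubmod_type W]_n) :
  sub_mnorm (x + y) <= sub_mnorm x + sub_mnorm y.
Proof. by rewrite /sub_mnorm map_mxD mnormD. Qed.

Let subZ n c (x : 'M[csubmod_type W]_n) :
  sub_mnorm (map_mx ( *:%R c) x) = normc c * sub_mnorm x.
Proof.
rewrite /sub_mnorm -mnormZ; congr mnorm.
by apply/matrixP => i j; rewrite !mxE.
Qed.

Let sub0 n (x : 'M[csubmod_type W]_n) : sub_mnorm x = 0 -> x = 0.
Proof.
move=> /mnorm0_eq0 /matrixP x0; apply/matrixP => i j.
by have := x0 i j; rewrite !mxE => xij; exact: val_inj.
Qed.

Let sub_block m n (x : 'M[csubmod_type W]_m) (y : 'M[csubmod_type W]_n) :
  sub_mnorm (block_mx x 0 0 y) = Num.max (sub_mnorm x) (sub_mnorm y).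
Proof. by rewrite /sub_mnorm map_block_mx !map_mx0 mnorm_block. Qed.

Let sub_act m n a (x : 'M[csubmod_type W]_n) b :
  sub_mnorm (mxact a x b : 'M[_]_m) <= opnorm a * sub_mnorm x * opnorm b.
Proof. by rewrite /sub_mnorm map_mxact mnorm_act. Qed.

Definition sub_opspace : opspace (csubmod_type W) :=
  OpSpace sub1 subD subZ sub0 sub_block sub_act.

Lemma csubmod_val_isometry : complete_isometry sub_opspace O (@csubmod_val _ _ W).
Proof. by []. Qed.

Definition sub_incl : cisom_embedding sub_opspace O :=
  @CIsomEmbedding _ _ sub_opspace O (@csubmod_val _ _ W) csubmod_val_isometry.
End Sub.

Section DirectSum.
Variables (X Y : normedModType C) (OX : opspace X) (OY : opspace Y).

Let dsum_mnorm n (x : 'M[(X * Y)%type]_n) : R :=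
  Num.max (mnorm OX (map_mx fst x)) (mnorm OY (map_mx snd x)).

Let dsum1 (x : 'M[(X * Y)%type]_1) : dsum_mnorm x = rnorm (x ord0 ord0).
Proof.
have maxC (r s : R) : (Num.max r s)%:C = Num.max r%:C s%:C.
  by rewrite /Order.max ltcR; case: ifP.
rewrite /dsum_mnorm !mnorm1 !mxE; apply: complexI.
by rewrite rnormE [RHS]prod_normE maxC !rnormE.
Qed.

Let dsumD n (x y : 'M[(X * Y)%type]_n) :
  dsum_mnorm (x + y) <= dsum_mnorm x + dsum_mnorm y.
Proof.
by rewrite /dsum_mnorm !map_mxD ge_max; apply/andP; split;
  (apply: le_trans (mnormD _ _ _) _); apply: lerD; rewrite le_max lexx ?orbT.
Qed.

Let dsumZ n c (x : 'M[(X * Y)%type]_n) :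
  dsum_mnorm (map_mx ( *:%R c) x) = normc c * dsum_mnorm x.
Proof.
rewrite /dsum_mnorm maxr_pMr ?normc_ge0// -!mnormZ.
by congr Num.max; congr mnorm; apply/matrixP => i j; rewrite !mxE.
Qed.

Let dsum0 n (x : 'M[(X * Y)%type]_n) : dsum_mnorm x = 0 -> x = 0.
Proof.
move=> x0.
have /mnorm0_eq0/matrixP x1 : mnorm OX (map_mx fst x) = 0.
  by apply/eqP; rewrite eq_le mnorm_ge0 andbT -x0 le_max lexx.
have /mnorm0_eq0/matrixP x2 : mnorm OY (map_mx snd x) = 0.
  by apply/eqP; rewrite eq_le mnorm_ge0 andbT -x0 le_max lexx orbT.
apply/matrixP => i j; have := x1 i j; have := x2 i j.
by rewrite !mxE; case: (x i j) => u v /= -> ->.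
Qed.

Let dsum_block m n (x : 'M[(X * Y)%type]_m) (y : 'M[(X * Y)%type]_n) :
  dsum_mnorm (block_mx x 0 0 y) = Num.max (dsum_mnorm x) (dsum_mnorm y).
Proof.
by rewrite /dsum_mnorm !map_block_mx !map_mx0 !mnorm_block maxACA.
Qed.

Let dsum_act m n a (x : 'M[(X * Y)%type]_n) b :
  dsum_mnorm (mxact a x b : 'M[_]_m) <= opnorm a * dsum_mnorm x * opnorm b.
Proof.
rewrite /dsum_mnorm !map_mxact ge_max; apply/andP; split;
  (apply: le_trans (mnorm_act _ _ _ _) _); rewrite ler_wpM2r ?opnorm_ge0//;
  by rewrite ler_wpM2l ?opnorm_ge0// le_max lexx ?orbT.
Qed.

Definition dsum_opspace : opspace (X * Y)%type :=
  OpSpace dsum1 dsumD dsumZ dsum0 dsum_block dsum_act.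
End DirectSum.

Section Quotient.
Variables (V : normedModType C) (O : opspace V) (W : closed_submodule V).
Local Notation piW := (@cquot_pi _ V W).

Let mpi n : {additive 'M[V]_n -> 'M[cquot W]_n} := map_mx piW.

Definition cquot_mnorm n : 'M[cquot W]_n -> R := infnorm (mpi n) (@mnorm _ O n).

Let mpi_surj n (q : 'M[cquot W]_n) : exists v, mpi n v = q.
Proof.
exists (map_mx (fun q => repr (q : lquot W)) q); apply/matrixP => i j.
by rewrite !mxE; exact: lquot_piK.
Qed.

Let quot1 (x : 'M[cquot W]_1) : cquot_mnorm x = rnorm (x ord0 ord0).
Proof.
rewrite cquot_normE /cquot_mnorm /cquot_rnorm /infnorm; congr inf.
apply/seteqP; split => _ [v /= vx <-].
  by exists (v ord0 ord0); rewrite /= ?mnorm1// -vx mxE.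
exists (const_mx v); last by rewrite mnorm1 mxE.
by apply/matrixP => i j; rewrite !ord1 !mxE.
Qed.

Let quotD n (x y : 'M[cquot W]_n) :
  cquot_mnorm (x + y) <= cquot_mnorm x + cquot_mnorm y.
Proof.
exact: (infnormD (@mpi_surj n) (@mnorm_ge0 _ O n) (@mnormD _ O n)).
Qed.

Let quotZle n c (x : 'M[cquot W]_n) :
  cquot_mnorm (map_mx ( *:%R c) x) <= normc c * cquot_mnorm x.
Proof.
apply: (infnormZ (@mpi_surj n) (@mnorm_ge0 _ O n) (s := map_mx ( *:%R c))).
- exact: normc_ge0.
- by move=> u; apply/matrixP => i j; rewrite !mxE; exact: cquot_piZ.
- by move=> u; rewrite mnormZ.
Qed.

Let quot_ge0 n (x : 'M[cquot W]_n) : 0 <= cquot_mnorm x.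
Proof. exact: (infnorm_ge0 (@mpi_surj n) (@mnorm_ge0 _ O n)). Qed.

Let quotZ n c (x : 'M[cquot W]_n) :
  cquot_mnorm (map_mx ( *:%R c) x) = normc c * cquot_mnorm x.
Proof.
apply/eqP; rewrite eq_le quotZle/=.
have [->|c0] := eqVneq c 0; first by rewrite normc0 mul0r.
have nc : 0 < normc c.
  rewrite lt_def normc_ge0 andbT; apply: contra c0 => /eqP h.
  by rewrite (eq0_normc h).
rewrite mulrC -ler_pdivlMr// mulrC -normcV; apply: le_trans (quotZle _ _).
rewrite le_eqVlt; apply/orP; left; apply/eqP; congr cquot_mnorm.
by apply/matrixP => i j; rewrite !mxE scalerK.
Qed.

Let quot0 n (x : 'M[cquot W]_n) : cquot_mnorm x = 0 -> x = 0.
Proof.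
move=> x0; apply/matrixP => i j; rewrite mxE; apply: rnorm0_eq0.
apply/eqP; rewrite eq_le rnorm_ge0 andbT -x0.
apply: (infnorm_ge (@mpi_surj n) (@mnorm_ge0 _ O n)) => u <-.
apply: le_trans (mnorm_entry O u i j); rewrite mxE cquot_normE.
by apply: infnorm_le; [exact: cquot_pi_surj|exact: rnorm_ge0].
Qed.

Let quot_act m n a (x : 'M[cquot W]_n) b :
  cquot_mnorm (mxact a x b : 'M[_]_m) <= opnorm a * cquot_mnorm x * opnorm b.
Proof.
have c0 : 0 <= opnorm a * opnorm b by rewrite mulr_ge0 ?opnorm_ge0.
rewrite mulrAC; apply/ler_addgt0Pr => e e0.
set c := opnorm a * opnorm b in c0 *.
have c1 : 0 < c + 1 by rewrite ltr_wpDl.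
have e1 : 0 < e / (c + 1) by rewrite divr_gt0.
have [u ux Nu] := infnorm_lt (@mpi_surj n) (@mnorm_ge0 _ O n) x e1.
apply: (@le_trans _ _ (mnorm O (mxact a u b))).
  have -> : mxact a x b = mpi m (mxact a u b) by rewrite -ux /= map_mxact.
  exact: (infnorm_le (@mpi_surj _) (@mnorm_ge0 _ O _)).
apply: le_trans (mnorm_act _ _ _ _) _; rewrite mulrAC -/c.
apply: le_trans (ler_wpM2l c0 (ltW Nu)) _.
rewrite mulrDr lerD2l mulrC -mulrA ler_piMr//; first exact: ltW.
by rewrite mulrC ler_pdivrMr// mul1r lerDl.
Qed.

Let act_le1 m n a (x : 'M[cquot W]_n) b : opnorm a <= 1 -> opnorm b <= 1 ->
  cquot_mnorm (mxact a x b : 'M[_]_m) <= cquot_mnorm x.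
Proof.
move=> a1 b1; apply: le_trans (quot_act _ _ _) _.
rewrite mulrAC ler_piMl// mulr_ile1 ?opnorm_ge0//.
Qed.

Let quot_block m n (x : 'M[cquot W]_m) (y : 'M[cquot W]_n) :
  cquot_mnorm (block_mx x 0 0 y) = Num.max (cquot_mnorm x) (cquot_mnorm y).
Proof.
apply/eqP; rewrite eq_le; apply/andP; split; last first.
  have [pr1 pr2] := opnorm_row_proj R m n; have [pc1 pc2] := opnorm_col_proj R m n.
  rewrite ge_max -{1}(mxact_blockl x y 0 0) -{3}(mxact_blockr x y 0 0).
  by rewrite !act_le1.
apply/ler_addgt0Pr => e e0.
have [u ux Nu] := infnorm_lt (@mpi_surj m) (@mnorm_ge0 _ O m) x e0.
have [v vy Nv] := infnorm_lt (@mpi_surj n) (@mnorm_ge0 _ O n) y e0.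
apply: (@le_trans _ _ (mnorm O (block_mx u 0 0 v))).
  have -> : block_mx x 0 0 y = mpi (m + n) (block_mx u 0 0 v).
    by rewrite -ux -vy /= map_block_mx !map_mx0.
  exact: (infnorm_le (@mpi_surj _) (@mnorm_ge0 _ O _)).
rewrite mnorm_block ge_max; apply/andP; split.
  by apply: le_trans (ltW Nu) _; rewrite lerD2r le_max lexx.
by apply: le_trans (ltW Nv) _; rewrite lerD2r le_max lexx orbT.
Qed.

Definition quot_opspace : opspace (cquot W) :=
  OpSpace quot1 quotD quotZ quot0 quot_block quot_act.
End Quotient.
End OperatorSpaces.

Section MIN.
Variables (R : realType) (E : normedModType R[i]).
Local Notation C := R[i].

(* sup over the unit balls of l^2_n of the norm of sum_ij a_i b_j x_ij; by
   Hahn-Banach it is also the sup of the operator norms of the scalar matrices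
   (f x_ij)_ij over the contractive functionals f on E. *)
Definition min_mnorm n (x : 'M[E]_n) : R :=
  sup [set r | exists (a : 'rV[C]_n) (b : 'cV[C]_n),
    [/\ l2norm a <= 1, l2norm b <= 1 & r = rnorm (mxact a x b ord0 ord0)]].

Let mset n (x : 'M[E]_n) : set R := [set r | exists (a : 'rV[C]_n) (b : 'cV[C]_n),
    [/\ l2norm a <= 1, l2norm b <= 1 & r = rnorm (mxact a x b ord0 ord0)]].

Let normc_le_l2 m n (A : 'M[C]_(m, n)) i j : normc (A i j) <= l2norm A.
Proof.
rewrite -(@ler_pXn2r _ 2) ?nnegrE ?normc_ge0 ?l2norm_ge0// sqr_l2norm.
rewrite (bigD1 i)//= (bigD1 j)//= -addrA lerDl addr_ge0//.
  by apply: sumr_ge0 => k _; rewrite sqr_ge0.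
by do 2 apply: sumr_ge0 => ? _; rewrite sqr_ge0.
Qed.

Let mset_sup n (x : 'M[E]_n) : has_sup (mset x).
Proof.
split.
  by exists (rnorm (mxact (0 : 'rV_n) x (0 : 'cV_n) ord0 ord0)), 0, 0;
    rewrite !l2norm0 ler01.
exists (\sum_k \sum_l rnorm (x k l)) => _ [a [b [a1 b1 ->]]].
rewrite mxE; apply: le_trans (rnorm_sum _ _) _; apply: ler_sum => k _.
apply: le_trans (rnorm_sum _ _) _; apply: ler_sum => l _.
rewrite rnormZ ler_piMl ?rnorm_ge0// normcM mulr_ile1 ?normc_ge0//.
  exact: le_trans (normc_le_l2 _ _ _) a1.
exact: le_trans (normc_le_l2 _ _ _) b1.
Qed.

Let min_le n (x : 'M[E]_n) (a : 'rV[C]_n) (b : 'cV[C]_n) :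
  l2norm a <= 1 -> l2norm b <= 1 -> rnorm (mxact a x b ord0 ord0) <= min_mnorm x.
Proof.
by move=> a1 b1; apply: (@sup_upper_bound _ (mset x)) => //; exists a, b.
Qed.

Let min_ge n (x : 'M[E]_n) (r : R) :
  (forall (a : 'rV[C]_n) (b : 'cV[C]_n), l2norm a <= 1 -> l2norm b <= 1 ->
    rnorm (mxact a x b ord0 ord0) <= r) -> min_mnorm x <= r.
Proof.
move=> h; apply: ge_sup; first by have [] := mset_sup x.
by move=> _ [a [b [a1 b1 ->]]]; exact: h.
Qed.

Let min_ge0 n (x : 'M[E]_n) : 0 <= min_mnorm x.
Proof.
by apply: le_trans (min_le x (a := 0) (b := 0) _ _); rewrite ?rnorm_ge0 ?l2norm0.
Qed.

Let min_bound n (x : 'M[E]_n) (a : 'rV[C]_n) (b : 'cV[C]_n) :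
  rnorm (mxact a x b ord0 ord0) <= l2norm a * min_mnorm x * l2norm b.
Proof.
have act0 m p (u : 'rV[C]_m) (y : 'M[E]_(m, p)) (v : 'cV[C]_p) :
    u = 0 \/ v = 0 -> rnorm (mxact u y v ord0 ord0) = 0.
  move=> uv; rewrite mxE big1 ?rnorm0// => k _; rewrite big1// => l _.
  by case: uv => ->; rewrite mxE ?mul0r ?mulr0 scale0r.
have [a0|an0] := eqVneq (l2norm a) 0.
  by rewrite a0 act0 ?mul0r//; left; exact: l2norm_eq0.
have [b0|bn0] := eqVneq (l2norm b) 0.
  by rewrite b0 act0 ?mulr0//; right; exact: l2norm_eq0.
have ap : 0 < l2norm a by rewrite lt_def an0 l2norm_ge0.
have bp : 0 < l2norm b by rewrite lt_def bn0 l2norm_ge0.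
have nc (r : R) : 0 <= r -> normc (r%:C) = r.
  by move=> r0; rewrite /= expr0n addr0 sqrtr_sqr ger0_norm.
pose r := (l2norm a)^-1; pose s := (l2norm b)^-1.
have r0 : 0 <= r by rewrite invr_ge0 ltW.
have s0 : 0 <= s by rewrite invr_ge0 ltW.
have := @min_le n x (r%:C *: a) (s%:C *: b).
rewrite !l2normZ !nc// !mulVf// => /(_ (lexx _) (lexx _)).
rewrite mxact_scale mxE rnormZ normcM !nc//.
set t := rnorm _ => h.
have ra : l2norm a * r = 1 by rewrite mulfV.
have sb : l2norm b * s = 1 by rewrite mulfV.
have -> : t = l2norm a * l2norm b * (r * s * t).
  by rewrite mulrA mulrACA ra sb !mul1r.
by rewrite [leRHS]mulrAC ler_wpM2l// mulr_ge0// ltW.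
Qed.

Let min1 (x : 'M[E]_1) : min_mnorm x = rnorm (x ord0 ord0).
Proof.
apply/eqP; rewrite eq_le; apply/andP; split.
  apply: min_ge => a b a1 b1; rewrite mxE !big_ord1 rnormZ ler_piMl ?rnorm_ge0//.
  rewrite normcM mulr_ile1 ?normc_ge0//.
    exact: le_trans (normc_le_l2 _ _ _) a1.
  exact: le_trans (normc_le_l2 _ _ _) b1.
rewrite -{1}(mxact_delta x) min_le//; apply: l2norm_le => //;
  by rewrite !big_ord1 mxE !eqxx normc1.
Qed.

Let minD n (x y : 'M[E]_n) : min_mnorm (x + y) <= min_mnorm x + min_mnorm y.
Proof.
apply: min_ge => a b a1 b1; rewrite mxactD mxE.
by apply: le_trans (rnormD _ _) _; apply: lerD; exact: min_le.
Qed.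

Let minZle n c (x : 'M[E]_n) :
  min_mnorm (map_mx ( *:%R c) x) <= normc c * min_mnorm x.
Proof.
apply: min_ge => a b a1 b1; rewrite mxact_map_scale mxE rnormZ.
by rewrite ler_wpM2l ?normc_ge0// min_le.
Qed.

Let minZ n c (x : 'M[E]_n) :
  min_mnorm (map_mx ( *:%R c) x) = normc c * min_mnorm x.
Proof.
apply/eqP; rewrite eq_le minZle/=.
have [->|c0] := eqVneq c 0; first by rewrite normc0 mul0r.
have nc : 0 < normc c.
  rewrite lt_def normc_ge0 andbT; apply: contra c0 => /eqP h.
  by rewrite (eq0_normc h).
rewrite mulrC -ler_pdivlMr// mulrC -normcV; apply: le_trans (minZle _ _).
rewrite le_eqVlt; apply/orP; left; apply/eqP; congr min_mnorm.
by apply/matrixP => i j; rewrite !mxE scalerK.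
Qed.

Let min0 n (x : 'M[E]_n) : min_mnorm x = 0 -> x = 0.
Proof.
move=> x0; apply/matrixP => i j; rewrite mxE; apply: rnorm0_eq0.
apply/eqP; rewrite eq_le rnorm_ge0 andbT -x0 -{1}(mxact_delta x).
by rewrite min_le// l2norm_delta.
Qed.

Let min_act m n a (x : 'M[E]_n) b :
  min_mnorm (mxact a x b : 'M[_]_m) <= opnorm a * min_mnorm x * opnorm b.
Proof.
apply: min_ge => u v u1 v1; rewrite mxactA.
apply: le_trans (min_bound _ _ _) _.
apply: ler_pM; rewrite ?l2norm_ge0 ?mulr_ge0 ?l2norm_ge0 ?min_ge0//.
  rewrite ler_wpM2r// ?min_ge0//; apply: le_trans (l2norm_mulrv _ _) _.
  by rewrite ler_piMr ?opnorm_ge0.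
apply: le_trans (l2norm_mulv _ _) _.
by rewrite ler_piMr ?opnorm_ge0.
Qed.

Let act_le1 m n a (x : 'M[E]_n) b : opnorm a <= 1 -> opnorm b <= 1 ->
  min_mnorm (mxact a x b : 'M[_]_m) <= min_mnorm x.
Proof.
move=> a1 b1; apply: le_trans (min_act _ _ _) _.
by rewrite mulrAC ler_piMl// mulr_ile1 ?opnorm_ge0.
Qed.

Let l2_row m n (a : 'rV[C]_(m + n)) :
  l2norm a ^+ 2 = l2norm (lsubmx a) ^+ 2 + l2norm (rsubmx a) ^+ 2.
Proof.
rewrite !sqr_l2norm !big_ord1 big_split_ord/=.
by congr (_ + _); apply: eq_bigr => i _; rewrite mxE.
Qed.

Let l2_col m n (a : 'cV[C]_(m + n)) :
  l2norm a ^+ 2 = l2norm (usubmx a) ^+ 2 + l2norm (dsubmx a) ^+ 2.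
Proof.
rewrite !sqr_l2norm big_split_ord/=.
by congr (_ + _); apply: eq_bigr => i _; rewrite !big_ord1 mxE.
Qed.

Let min_block m n (x : 'M[E]_m) (y : 'M[E]_n) :
  min_mnorm (block_mx x 0 0 y) = Num.max (min_mnorm x) (min_mnorm y).
Proof.
apply/eqP; rewrite eq_le; apply/andP; split; last first.
  have [pr1 pr2] := opnorm_row_proj R m n; have [pc1 pc2] := opnorm_col_proj R m n.
  rewrite ge_max -{1}(mxact_blockl x y 0 0) -{3}(mxact_blockr x y 0 0).
  by rewrite !act_le1.
set M := Num.max _ _.
have M0 : 0 <= M by rewrite le_max min_ge0.
apply: min_ge => a b a1 b1.
rewrite -(hsubmxK a) -(vsubmxK b) mxact_block mxE.
apply: le_trans (rnormD _ _) _.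
set a1' := lsubmx a; set a2' := rsubmx a; set b1' := usubmx b; set b2' := dsubmx b.
have hx : rnorm (mxact a1' x b1' ord0 ord0) <= M * (l2norm a1' * l2norm b1').
  apply: le_trans (min_bound _ _ _) _; rewrite mulrAC mulrC ler_wpM2r//.
    by rewrite mulr_ge0 ?l2norm_ge0.
  by rewrite le_max lexx.
have hy : rnorm (mxact a2' y b2' ord0 ord0) <= M * (l2norm a2' * l2norm b2').
  apply: le_trans (min_bound _ _ _) _; rewrite mulrAC mulrC ler_wpM2r//.
    by rewrite mulr_ge0 ?l2norm_ge0.
  by rewrite le_max lexx orbT.
apply: le_trans (lerD hx hy) _; rewrite -mulrDr ler_piMr//.
have a2 : l2norm a1' ^+ 2 + l2norm a2' ^+ 2 <= 1.
  by rewrite -l2_row expr_le1 ?l2norm_ge0.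
have b2 : l2norm b1' ^+ 2 + l2norm b2' ^+ 2 <= 1.
  by rewrite -l2_col expr_le1 ?l2norm_ge0.
have := sqr_ge0 (l2norm a1' - l2norm b1').
have := sqr_ge0 (l2norm a2' - l2norm b2').
rewrite !sqrrB => h1 h2; lra.
Qed.

Definition min_opspace : opspace E :=
  OpSpace min1 minD minZ min0 min_block min_act.

Lemma min_opspace_minimal : minimal_opspace min_opspace.
Proof.
move=> Y OY T T1 n x; apply: min_ge => a b a1 b1.
rewrite -map_mxact mxE; apply: le_trans (T1 _) _.
have := mnorm_act OY a x b; rewrite mnorm1 => /le_trans; apply.
rewrite mulrAC ler_piMl ?mnorm_ge0// mulr_ile1 ?opnorm_ge0//.
  exact: le_trans (opnorm_le_l2 _) a1.
exact: le_trans (opnorm_le_l2 _) b1.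
Qed.

Lemma MIN_exists : exists O : opspace E, minimal_opspace O.
Proof. by exists min_opspace; exact: min_opspace_minimal. Qed.

Lemma MIN_unique (O1 O2 : opspace E) :
  minimal_opspace O1 -> minimal_opspace O2 ->
  forall n (x : 'M[E]_n), mnorm O1 x = mnorm O2 x.
Proof.
move=> m1 m2 n x; apply/eqP; rewrite eq_le; apply/andP; split.
  by have := m1 E O2 idfun (fun=> lexx _) n x; rewrite map_mx_id.
by have := m2 E O1 idfun (fun=> lexx _) n x; rewrite map_mx_id.
Qed.

(* The minimal operator space structure on E; unique by MIN_unique. *)
Definition MIN : opspace E := sval (cid MIN_exists).

Lemma MIN_minimal : minimal_opspace MIN.
Proof. exact: svalP (cid MIN_exists). Qed.
End MIN.

Section AmalgamatedSum.
Variables (R : realType) (X Y Z : normedModType R[i]).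
Variables (OX : opspace X) (OY : opspace Y) (OZ : opspace Z).
Variables (i : cisom_embedding OZ OX) (j : cisom_embedding OZ OY).

Definition amalg_sub : closed_submodule (X * Y)%type :=
  clspan (range (fun z : Z => (i z, - j z))).

Definition amalg_sum : opspace (cquot amalg_sub) :=
  quot_opspace (dsum_opspace OX OY) amalg_sub.
End AmalgamatedSum.

Section Linfty.
Context (R : realType) (d : measure_display) (T : measurableType d)
        (P : probability T R).
Local Notation C := R[i].

(* The Borel structure of the complex plane is that of R * R. *)
Definition cplane (z : C) : R * R := (complex.Re z, complex.Im z).

Definition ess_supc (f : T -> C) : \bar R :=
  ess_sup P (fun w => (normc (f w))%:E).

(* Measurable, essentially bounded functions; Linf is their quotient by
   almost everywhere equality. *)
Definition Linf_fun : {pred T -> C} :=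
  [pred f | `[< measurable_fun [set: T] (cplane \o f) /\
               (ess_supc f < +oo)%E >]].

Let Linf_funP f : reflect
  (measurable_fun [set: T] (cplane \o f) /\
     exists M : R, \forall w \ae P, normc (f w) <= M)
  (f \in Linf_fun).
Proof.
apply: (iffP (asboolP _)) => -[mf bf]; split => //.
- have := ess_sup_ge P (fun w => (normc (f w))%:E); rewrite -/(ess_supc f).
  case: (ess_supc f) bf => [M _|//|_] h.
    by exists M; apply: filterS h => w; rewrite lee_fin.
  by exists 0; apply: filterS h => w; rewrite leeNy_eq.
- case: bf => M bM; apply: (@le_lt_trans _ _ M%:E); last by rewrite ltry.
  by apply/ess_supP; apply: filterS bM => w; rewrite lee_fin.
Qed.

Lemma Linf_fun_submod_closed : submod_closed Linf_fun.
Proof.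
split=> [|c f g /Linf_funP[mf [M fM]] /Linf_funP[mg [N gN]]]; apply/Linf_funP.
  split; first by apply: (@measurable_cst _ _ _ _ _ ((0, 0) : R * R)).
  by exists 0; apply: nearW => w; rewrite normc0.
split; last first.
  exists (normc c * M + N); apply: filterS2 fM gN => w fM gN.
  apply: le_trans (le_normcD _ _) _; apply: lerD => //.
  by rewrite normcM ler_wpM2l// normc_ge0.
have [mf1 mf2] := (measurable_fun_pairP _).1 mf.
have [mg1 mg2] := (measurable_fun_pairP _).1 mg.
have hRe (a b e : C) : complex.Re (a * b + e) =
    complex.Re a * complex.Re b - complex.Im a * complex.Im b + complex.Re e.
  by case: a b e => [? ?] [? ?] [? ?].
have hIm (a b e : C) : complex.Im (a * b + e) =
    complex.Re a * complex.Im b + complex.Im a * complex.Re b + complex.Im e.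
  by case: a b e => [? ?] [? ?] [? ?].
have Rec w : complex.Re ((c *: f + g) w) =
    complex.Re c * complex.Re (f w) - complex.Im c * complex.Im (f w)
    + complex.Re (g w).
  rewrite -[(_ + _) w]/(c * f w + g w).
  exact: hRe.
have Imc w : complex.Im ((c *: f + g) w) =
    complex.Re c * complex.Im (f w) + complex.Im c * complex.Re (f w)
    + complex.Im (g w).
  rewrite -[(_ + _) w]/(c * f w + g w).
  exact: hIm.
apply/measurable_fun_pairP; split.
  rewrite (_ : _ \o _ = fun w => complex.Re ((c *: f + g) w))//.
  under eq_fun do rewrite Rec.
  apply: measurable_funD => //; apply: measurable_funB; exact: measurable_funM.
rewrite (_ : _ \o _ = fun w => complex.Im ((c *: f + g) w))//.
under eq_fun do rewrite Imc.
apply: measurable_funD => //; apply: measurable_funD; exact: measurable_funM.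
Qed.

Definition Linf_fun_submod : submodule (T -> C) :=
  Submodule Linf_fun_submod_closed.

Local Notation Lfunc := (submod_type Linf_fun_submod).

Definition Linf_null : {pred Lfunc} :=
  [pred f | `[< \forall w \ae P, (\val f : T -> C) w = 0 >]].

Lemma Linf_null_submod_closed : submod_closed Linf_null.
Proof.
split=> [|c f g /asboolP f0 /asboolP g0]; apply/asboolP; first exact: nearW.
apply: filterS2 f0 g0 => w fw gw.
rewrite submod_valP.
by rewrite -[LHS]/(c * (\val f : T -> C) w + (\val g : T -> C) w) fw gw mulr0 addr0.
Qed.

Definition Linf_null_submod : submodule Lfunc := Submodule Linf_null_submod_closed.

Definition Linf : Type := lquot Linf_null_submod.
HB.instance Definition _ := GRing.Lmodule.on Linf.

Definition Linf_class (f : T -> C) (Lf : f \in Linf_fun) : Linf :=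
  lquot_pi Linf_null_submod (exist _ f Lf : Lfunc).

Definition Linf_repr (u : Linf) : T -> C := \val (repr (u : lquot Linf_null_submod)).

Lemma Linf_classK f (Lf : f \in Linf_fun) :
  \forall w \ae P, Linf_repr (Linf_class Lf) w = f w.
Proof.
have := lquot_piK (Linf_class Lf) => /lquot_eq /asboolP.
by apply: filterS => w; rewrite submod_valB => /eqP; rewrite subr_eq0 => /eqP.
Qed.

Lemma Linf_reprP (u : Linf) : Linf_repr u \in Linf_fun.
Proof. exact: (valP (repr (u : lquot Linf_null_submod))). Qed.

Lemma Linf_reprK (u : Linf) : Linf_class (Linf_reprP u) = u.
Proof.
rewrite -[RHS](lquot_piK (u : lquot Linf_null_submod)).
by congr (lquot_pi _ _); exact: val_inj.
Qed.

Lemma Linf_eq (u v : Linf) :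
  (\forall w \ae P, Linf_repr u w = Linf_repr v w) -> u = v.
Proof.
move=> uv; rewrite -(Linf_reprK u) -(Linf_reprK v); apply/lquot_eq/asboolP.
by apply: filterS uv => w /eqP; rewrite -subr_eq0 submod_valB => /eqP.
Qed.

Let lquot_ae (f g : Lfunc) :
  lquot_pi Linf_null_submod f = lquot_pi Linf_null_submod g ->
  \forall w \ae P, (\val f : T -> C) w = (\val g : T -> C) w.
Proof.
move=> /lquot_eq/asboolP; apply: filterS => w; rewrite submod_valB.
by move=> /eqP; rewrite subr_eq0 => /eqP.
Qed.

Lemma Linf_reprD (u v : Linf) :
  \forall w \ae P, Linf_repr (u + v) w = Linf_repr u w + Linf_repr v w.
Proof.
have : lquot_pi Linf_null_submod (repr (u + v : lquot Linf_null_submod)) =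
    lquot_pi Linf_null_submod
      (repr (u : lquot Linf_null_submod) + repr (v : lquot Linf_null_submod)).
  by rewrite lquot_piD !lquot_piK.
by move=> /lquot_ae; apply: filterS => w; rewrite submod_valD.
Qed.

Lemma Linf_reprZ c (u : Linf) :
  \forall w \ae P, Linf_repr (c *: u) w = c * Linf_repr u w.
Proof.
have : lquot_pi Linf_null_submod (repr (c *: u : lquot Linf_null_submod)) =
    lquot_pi Linf_null_submod (c *: repr (u : lquot Linf_null_submod)).
  by rewrite lquot_piZ !lquot_piK.
by move=> /lquot_ae; apply: filterS => w; rewrite submod_valZ.
Qed.

Lemma Linf_repr0 : \forall w \ae P, Linf_repr 0 w = 0.
Proof. by apply: filterS (Linf_reprZ 0 0) => w; rewrite scale0r mul0r. Qed.

Definition Linf_rnorm (u : Linf) : R := fine (ess_supc (Linf_repr u)).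

Let ess_supc_ge0 f : (0 <= ess_supc f)%E.
Proof.
have P1 : (0 < P [set: T])%E by rewrite probability_setT lte01.
apply: ess_sup_gee => //.
by apply: nearW => w; rewrite lee_fin normc_ge0.
Qed.

Let Linf_rnormK u : (Linf_rnorm u)%:E = ess_supc (Linf_repr u).
Proof.
by rewrite fineK// ge0_fin_numE//; have /asboolP[] := Linf_reprP u.
Qed.

Lemma Linf_rnorm_ae (u : Linf) : \forall w \ae P, normc (Linf_repr u w) <= Linf_rnorm u.
Proof.
have := ess_sup_ge P (fun w => (normc (Linf_repr u w))%:E).
by rewrite -/(ess_supc _) -Linf_rnormK; apply: filterS => w; rewrite lee_fin.
Qed.

Lemma Linf_rnorm_le (u : Linf) (M : R) :
  (\forall w \ae P, normc (Linf_repr u w) <= M) -> Linf_rnorm u <= M.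
Proof.
move=> uM; rewrite -lee_fin Linf_rnormK; apply/ess_supP.
by apply: filterS uM => w; rewrite lee_fin.
Qed.

Let Linf_norm (u : Linf) : C := (Linf_rnorm u)%:C.

Let Linf_normD u v : Linf_norm (u + v) <= Linf_norm u + Linf_norm v.
Proof.
rewrite -rmorphD lecR; apply: Linf_rnorm_le.
apply: filterS3 (Linf_reprD u v) (Linf_rnorm_ae u) (Linf_rnorm_ae v) => w -> hu hv.
by apply: le_trans (le_normcD _ _) _; exact: lerD.
Qed.

Let Linf_rnormZle c u : Linf_rnorm (c *: u) <= normc c * Linf_rnorm u.
Proof.
apply: Linf_rnorm_le; apply: filterS2 (Linf_reprZ c u) (Linf_rnorm_ae u) => w -> hu.
by rewrite normcM ler_wpM2l ?normc_ge0.
Qed.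

Let Linf_rnorm_ge0 u : 0 <= Linf_rnorm u.
Proof. by rewrite -lee_fin Linf_rnormK. Qed.

Let Linf_normZ c u : Linf_norm (c *: u) = `|c| * Linf_norm u.
Proof.
rewrite normr_normc -rmorphM; congr (_%:C); apply/eqP.
rewrite eq_le Linf_rnormZle/=.
have [->|c0] := eqVneq c 0; first by rewrite normc0 mul0r.
have nc : 0 < normc c.
  rewrite lt_def normc_ge0 andbT; apply: contra c0 => /eqP h.
  by rewrite (eq0_normc h).
rewrite mulrC -ler_pdivlMr// mulrC -normcV -[u in leLHS](scalerK c0).
exact: Linf_rnormZle.
Qed.

Let Linf_norm0_eq0 u : Linf_norm u = 0 -> u = 0.
Proof.
move=> /complexI u0; apply: Linf_eq.
apply: filterS2 (Linf_rnorm_ae u) Linf_repr0 => w uw ->.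
apply: eq0_normc; apply/eqP; rewrite eq_le normc_ge0 andbT.
by rewrite u0 in uw.
Qed.

HB.instance Definition _ := Lmodule_isNormed.Build C Linf
  Linf_normD Linf_normZ Linf_norm0_eq0.

Lemma Linf_normE (u : Linf) : `|u| = (fine (ess_supc (Linf_repr u)))%:C.
Proof. by []. Qed.

(* The law of s is the image of Lebesgue measure on [0, 1] under
   t |-> exp (2 pi i t). *)
Definition steinhaus (s : T -> C) :=
  measurable_fun [set: T] (cplane \o s) /\
  forall B : set (R * R), measurable B ->
    P ((cplane \o s) @^-1` B) =
    lebesgue_measure (`[0, 1] `&`
      (fun t : R => (cos (2 * pi * t), sin (2 * pi * t))) @^-1` B).

Lemma steinhaus_Linf s : steinhaus s -> s \in Linf_fun.
Proof.
move=> [ms hs]; apply/Linf_funP; split => //; exists 1.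
pose B : set (R * R) := (fun p => p.1 ^+ 2 + p.2 ^+ 2) @^-1` `]1, +oo[%classic.
have mB : measurable B.
  rewrite /B -[_ @^-1` _]setTI.
  have m : measurable_fun [set: R * R] (fun p : R * R => p.1 ^+ 2 + p.2 ^+ 2).
    by apply: measurable_funD; apply: measurable_funX.
  by apply: m => //; exact: measurable_itv.
exists ((cplane \o s) @^-1` B); split.
- by rewrite -[_ @^-1` _]setTI; exact: ms.
- rewrite hs// (_ : _ `&` _ = set0) ?measure0//.
  by apply/seteqP; split => // t [_]; rewrite /B /= cos2Dsin2 in_itv/= ltxx.
- move=> w /= /negP; rewrite -ltNge /B /= in_itv/= andbT.
  case: (s w) => a b /= h; rewrite ltNge; apply/negP => h'; move: h.
  by rewrite ltNge -sqrtr1 ler_wsqrtr.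
Qed.

Definition mutually_independent d' (T' : measurableType d') (X : nat -> T -> T') :=
  forall (J : seq nat) (B : nat -> set T'), uniq J ->
    (forall n, measurable (B n)) ->
    P (\bigcap_(n in [set` J]) (X n @^-1` B n)) =
    (\prod_(n <- J) P (X n @^-1` B n))%E.
End Linfty.

Arguments cplane {R} z.

(* Main.v *)
(* For x in X the class of (x, -x) in the amalgamated sum has norm dist(x, Z),
   so it suffices to look at X/Z, and there at columns (q_1, ..., q_n) of classes
   of x_i in X.  In a minimal structure the norm of such a column is
   sup dist(sum_i a_i x_i, Z) over the unit ball of l_2^n, whereas in X/Z it is
   the infimum, over lifts p_i in x_i + Z, of sup |sum_i a_i p_i|.

   Let U be a symmetric Hadamard matrix of order n, g_i = n^-1 sum_k U_ik s_k in Z,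
   so that sum_i |g_i|^2 <= 1, and let x_i = g_i log |g_i| (a Kalton-Peck twist).
   Since |a||g| |log|a| - log|g|| <= |a|^2 + |g|^2, the combination sum_i a_i x_i
   is at distance at most 2 from sum_i (a_i log |a_i|) g_i, an element of Z.

   Conversely let p_i = x_i + z_i with z_i in Z and |sum_i a_i p_i| <= M on the
   unit ball.  By independence the vector (s_k)_k comes close to every
   unimodular vector, in particular to the columns of E U for a diagonal
   unimodular matrix E.  Testing with a = conj g and averaging over the columns,
   the contribution of the z_i does not depend on E.  For E = 1 the vector g is a
   basis vector and x is bounded; for a diagonal D such that U D U is flat, each
   |g_i| is n^-1/2 and the contribution of the x_i is about -(log n)/2.  Hence
   log n is bounded in terms of M, a contradiction. *)
Require Import Defs.
From mathcomp Require Import all_boot all_order all_algebra complex ring lra.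
From mathcomp Require Import all_classical all_reals all_analysis.
From mathcomp Require Import ess_sup_inf measurable_realfun.

Set Implicit Arguments.
Unset Strict Implicit.
Unset Printing Implicit Defensive.

Import Order.TTheory GRing.Theory Num.Theory.
Import numFieldNormedType.Exports.
Import ComplexField.Normc.

Local Open Scope complex_scope.
Local Open Scope classical_set_scope.
Local Open Scope ring_scope.

(** * Complex numbers *)

Section Complex.
Variable R : realType.
Local Notation C := R[i].
Implicit Types (z w : C) (a b t : R).

(** For 0 < a <= b use ln (b / a) <= b / a - 1. If an argument is 0, the factor [a * b] vanishes,
    whatever value [ln] takes there. *)
Lemma mulM_ln_le a b : 0 <= a -> 0 <= b ->
  a * b * `|ln a - ln b| <= a ^+ 2 + b ^+ 2.
Proof.
have key (c e : R) : 0 < c -> 0 < e -> c <= e ->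
    c * e * `|ln c - ln e| <= c ^+ 2 + e ^+ 2.
  move=> c0 e0 ce.
  rewrite ler0_norm ?subr_le0 ?ler_ln// opprB -ln_div//.
  have h : ln (e / c) <= e / c - 1.
    by have := @le_ln1Dx R (e / c - 1); rewrite addrCA subrr addr0;
      apply; rewrite ltrBrDr addNr divr_gt0.
  apply: le_trans (ler_wpM2l _ h) _; first by rewrite mulr_ge0// ltW.
  have -> : c * e * (e / c - 1) = e ^+ 2 - c * e by field; rewrite gt_eqF.
  have := mulr_ge0 (ltW c0) (ltW e0); have := sqr_ge0 c; lra.
move=> + +; rewrite 2![0 <= _]le_eqVlt => /predU1P[<-|a0] /predU1P[<-|b0];
  rewrite ?(mul0r,mulr0) ?addr_ge0 ?sqr_ge0//.
have [ab|/ltW ab] := leP a b; first exact: key.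
by rewrite distrC (mulrC a) (addrC (a ^+ 2)); apply: key.
Qed.

Lemma normc_ReIm z : normc z ^+ 2 = complex.Re z ^+ 2 + complex.Im z ^+ 2.
Proof. by case: z => a b; rewrite sqr_sqrtr// addr_ge0// sqr_ge0. Qed.

Lemma mulcJ_normc z : z^* * z = (normc z ^+ 2)%:C.
Proof.
rewrite normc_ReIm; case: z => a b.
by apply/eqP; rewrite eq_complex/=; apply/andP; split; apply/eqP; ring.
Qed.

Lemma normc_conj z : normc z^* = normc z.
Proof. by case: z => a b; rewrite /= sqrrN. Qed.

Lemma normc_real a : normc a%:C = `|a|.
Proof. by rewrite /= expr0n addr0 sqrtr_sqr. Qed.

Lemma ler_Re_normc z : `|complex.Re z| <= normc z.
Proof.
rewrite -(@ler_pXn2r _ 2) ?nnegrE// ?normc_ge0// real_normK ?num_real//.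
by rewrite normc_ReIm lerDl sqr_ge0.
Qed.

Lemma normc_unity4 z : z ^+ 4 = 1 -> normc z = 1.
Proof.
move=> z4; apply/eqP; rewrite -(@pexpr_eq1 _ _ 4) ?normc_ge0//.
have nX k : normc (z ^+ k) = normc z ^+ k.
  by elim: k => [|k IH]; rewrite ?expr0 ?normc1// !exprS normcM IH.
by rewrite -nX z4 normc1.
Qed.

Lemma unity4_cases z : z ^+ 4 = 1 -> [\/ z = 1, z = -1, z = 'i%C | z = - 'i%C].
Proof.
move=> z4; have : (z ^+ 2 - 1) * (z ^+ 2 + 1) = 0.
  by rewrite -subr_sqr -exprM z4 expr1n subrr.
move/eqP; rewrite mulf_eq0 => /orP[|].
  by rewrite subr_eq0 sqrf_eq1 => /orP[/eqP ->|/eqP ->]; [constructor 1|constructor 2].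
rewrite -[1]opprK -(sqr_i R) subr_eq0 eqf_sqr.
by move=> /orP[/eqP ->|/eqP ->]; [constructor 3|constructor 4].
Qed.

(** The Kalton-Peck function; at 0 the factor [z] hides the default value of [ln]. *)
Definition xlog z : C := (ln (normc z))%:C * z.

Lemma normc_xlog z : normc (xlog z) <= normc z ^+ 2 + 1.
Proof.
have := mulM_ln_le (normc_ge0 z) ler01.
by rewrite ln1 subr0 mulr1 expr1n /xlog normcM normc_real mulrC.
Qed.

Lemma normc_le_ReIm z : normc z <= `|complex.Re z| + `|complex.Im z|.
Proof.
rewrite -(@ler_pXn2r _ 2) ?nnegrE ?normc_ge0 ?addr_ge0// normc_ReIm.
rewrite sqrrD !real_normK ?num_real// lerD2r lerDl.
by rewrite mulrn_wge0// mulr_ge0.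
Qed.

Lemma normc_nat m : normc (m%:R : C) = m%:R.
Proof. by rewrite -(rmorph_nat (real_complex R)) normc_real ger0_norm. Qed.
End Complex.

(** * Bent Hadamard matrices whose order is a power of two *)

Section Hadamard.
Variable R : realType.
Local Notation C := R[i].

(* The diagonal [D] is bent: conjugating it by [U] spreads it evenly over all
   entries. *)
Record bent_hadamard (I : finType) (U : I -> I -> C) (D : I -> C) : Prop :=
  BentHadamard {
  bh_sign : forall i k, U i k ^+ 2 = 1;
  bh_sym : forall i k, U i k = U k i;
  bh_orth : forall i j, \sum_k U i k * U k j = (i == j)%:R * #|I|%:R;
  bh_unity : forall k, D k ^+ 4 = 1;
  bh_bent : forall i j, normc (\sum_k U i k * (D k * U k j)) ^+ 2 = #|I|%:R }.

(** With D = diag(1, i) the entries of U D U are 1 + i and 1 - i, of squared modulus 2. *)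
Lemma bent_hadamard_bool : bent_hadamard (fun a b : bool => (-1) ^+ (a && b))
  (fun b => if b then 'i%C else 1).
Proof.
split.
- by case=> [] [] /=; rewrite ?expr1 ?sqrrN ?expr0 expr1n.
- by move=> i k; rewrite andbC.
- case=> [] [] /=; rewrite big_bool/= card_bool ?expr1 ?expr0 ?mul1r ?mulN1r ?opprK ?mul0r//.
  + by rewrite addNr.
  + by rewrite addrC subrr.
- by case; rewrite ?expr1n// -[4%N]/(2 * 2)%N exprM sqr_i sqrrN expr1n.
- by case=> [] []; rewrite normc_ReIm big_bool card_bool ?(expr1, expr0) /=; ring.
Qed.

(** Sums over [I * J] factor, so every condition passes to Kronecker products. *)
Lemma bent_hadamard_prod (I J : finType) (U : I -> I -> C) D (V : J -> J -> C) E :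
  bent_hadamard U D -> bent_hadamard V E ->
  bent_hadamard (fun i k : I * J => U i.1 k.1 * V i.2 k.2) (fun k => D k.1 * E k.2).
Proof.
have sumM (F : I -> C) (G : J -> C) :
    \sum_(k : I * J) F k.1 * G k.2 = (\sum_i F i) * (\sum_j G j).
  by rewrite big_distrlr/= pair_bigA.
move=> [sU symU oU uD bU] [sV symV oV uE bV]; split.
- by move=> i k; rewrite exprMn sU sV mulr1.
- by move=> i k; rewrite symU symV.
- move=> i j; rewrite (eq_bigr (fun k => (U i.1 k.1 * U k.1 j.1) * (V i.2 k.2 * V k.2 j.2))).
    rewrite (sumM (fun k => U i.1 k * U k j.1) (fun k => V i.2 k * V k j.2)) oU oV.
    rewrite card_prod natrM mulrACA; congr (_ * _).
    by case: i j => [? ?] [? ?]; rewrite xpair_eqE -natrM mulnb.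
  by move=> k _; ring.
- by move=> k; rewrite exprMn uD uE mulr1.
- move=> i j; rewrite (eq_bigr (fun k => (U i.1 k.1 * (D k.1 * U k.1 j.1))
      * (V i.2 k.2 * (E k.2 * V k.2 j.2)))).
    rewrite (sumM (fun k => U i.1 k * (D k * U k j.1)) (fun k => V i.2 k * (E k * V k j.2))).
    by rewrite normcM exprMn bU bV card_prod natrM.
  by move=> k _; ring.
Qed.

Lemma exists_bent_hadamard m : exists (I : finType) (U : I -> I -> C) (D : I -> C),
  #|I| = (2 ^ m.+1)%N /\ bent_hadamard U D.
Proof.
elim: m => [|m [I [U [D [cI h]]]]].
  by exists bool; do 2 eexists; split; [rewrite card_bool|exact: bent_hadamard_bool].
exists (I * bool)%type; do 2 eexists; split; last first.
  exact: bent_hadamard_prod h bent_hadamard_bool.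
by rewrite card_prod cI card_bool mulnC -expnS.
Qed.
End Hadamard.

(** * Walsh coefficients and averages over test points *)

Section Walsh.
Variables (R : realType) (I : finType).
Local Notation C := R[i].
Local Notation n := #|I|.
Variables (U : I -> I -> C) (D : I -> C).
Hypotheses (h : bent_hadamard U D) (n_gt0 : (0 < n)%N).

Definition walsh (t : I -> C) (i : I) : C := n%:R^-1 * \sum_k U i k * t k.

Let n_neq0 : n%:R != 0 :> C. Proof. by rewrite pnatr_eq0 -lt0n. Qed.
Let nR_gt0 : 0 < n%:R :> R. Proof. by rewrite ltr0n. Qed.

Lemma bh_conj i k : (U i k)^* = U i k.
Proof.
have /eqP := bh_sign h i k; rewrite sqrf_eq1 => /orP[/eqP ->|/eqP ->];
  by rewrite ?rmorphN1 ?rmorph1.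
Qed.

Lemma bh_norm i k : normc (U i k) = 1.
Proof. by apply: normc_unity4; rewrite -[4%N]/(2 * 2)%N exprM (bh_sign h) expr1n. Qed.

(** Parseval's identity: [U] is sqrt n times a unitary matrix. The factor 1 / n in [walsh] makes the
    square sum 1 for unimodular [t]. *)
Lemma walsh_sum_sqr t :
  \sum_i normc (walsh t i) ^+ 2 = n%:R^-1 * \sum_k normc (t k) ^+ 2.
Proof.
apply: complexI; rewrite rmorphM/= fmorphV/= rmorph_nat !rmorph_sum/=.
transitivity (n%:R^-2 * \sum_i \sum_k \sum_l (U i k * U i l) * ((t k)^* * t l)).
  rewrite mulr_sumr; apply: eq_bigr => i _; rewrite -mulcJ_normc /walsh rmorphM.
  rewrite fmorphV rmorph_nat rmorph_sum mulrACA -expr2 exprVn; congr (_ * _).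
  rewrite big_distrlr/=; apply: eq_bigr => k _; apply: eq_bigr => l _.
  by rewrite rmorphM/= bh_conj; ring.
rewrite exchange_big/=.
transitivity (n%:R^-2 * \sum_k n%:R * ((t k)^* * t k)).
  congr (_ * _); apply: eq_bigr => k _; rewrite exchange_big/=.
  transitivity (\sum_l (k == l)%:R * n%:R * ((t k)^* * t l)).
    apply: eq_bigr => l _; rewrite -mulr_suml -(bh_orth h); congr (_ * _).
    by apply: eq_bigr => i _; rewrite (bh_sym h i k).
  rewrite (bigD1 k)//= eqxx mul1r big1 ?addr0// => l lk.
  by rewrite eq_sym (negPf lk) !mul0r.
rewrite -mulr_sumr mulrA exprSr invfM divfK//; congr (_ * _).
by apply: eq_bigr => k _; rewrite mulcJ_normc.
Qed.

Lemma walsh_sum_sqr_le1 t : (forall k, normc (t k) <= 1) ->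
  \sum_i normc (walsh t i) ^+ 2 <= 1.
Proof.
move=> t1; rewrite walsh_sum_sqr mulrC ler_pdivrMr// mul1r -sumr_const.
by apply: ler_sum => k _; rewrite exprn_ile1// normc_ge0.
Qed.

Lemma walsh_le1 t i : (forall k, normc (t k) <= 1) -> normc (walsh t i) <= 1.
Proof.
move=> t1; rewrite -(@expr_le1 _ 2)// ?normc_ge0//.
apply: le_trans (walsh_sum_sqr_le1 t1); rewrite (bigD1 i)//= lerDl.
by apply: sumr_ge0 => k _; rewrite sqr_ge0.
Qed.

Lemma walsh_dist t u (e : R) i : (forall k, normc (t k - u k) <= e) ->
  normc (walsh t i - walsh u i) <= e.
Proof.
move=> tu; rewrite /walsh -mulrBr -sumrB normcM normcV normc_nat.
rewrite mulrC ler_pdivrMr//; apply: le_trans (normc_sum _ _) _.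
rewrite -sumr_const mulr_sumr; apply: ler_sum => k _.
by rewrite -mulrBr normcM bh_norm mul1r mulr1.
Qed.

Lemma walsh_row i j : walsh (fun k => U k j) i = (i == j)%:R.
Proof. by rewrite /walsh (bh_orth h) mulrC mulfK. Qed.

Lemma walsh_bent i j : normc (walsh (fun k => D k * U k j) i) ^+ 2 = n%:R^-1.
Proof.
rewrite /walsh normcM exprMn (bh_bent h) normcV normc_nat expr2 -mulrA mulVf ?mulr1//.
by rewrite gt_eqF.
Qed.

(** Orthogonality leaves only the term l = k, where the conjugate of [E k] meets [E k]; hence [E]
    drops out. *)
Lemma walsh_dual (E : I -> C) i k : (forall l, normc (E l) = 1) ->
  \sum_j (walsh (fun l => E l * U l j) i)^* * (E k * U k j) = U i k.
Proof.
move=> E1.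
transitivity (n%:R^-1 * \sum_l (U i l * (E l)^* * E k) * \sum_j U l j * U j k).
  transitivity (\sum_j \sum_l n%:R^-1 * (U i l * (E l)^* * E k * (U l j * U j k))).
    apply: eq_bigr => j _; rewrite /walsh rmorphM/= fmorphV/= rmorph_nat rmorph_sum/=.
    rewrite mulr_sumr mulr_suml; apply: eq_bigr => l _.
    by rewrite !rmorphM/= !bh_conj (bh_sym h k j); ring.
  rewrite exchange_big/= mulr_sumr; apply: eq_bigr => l _.
  by rewrite [in RHS]mulr_sumr [in RHS]mulr_sumr.
rewrite (bigD1 k)//= [X in _ + X]big1 ?addr0 => [|l lk]; last first.
  by rewrite (bh_orth h) (negPf lk) mul0r mulr0.
rewrite (bh_orth h) eqxx mul1r -(mulrA (U i k)) mulcJ_normc E1 expr1n.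
by rewrite rmorph1 mulr1 mulrCA mulVf ?mulr1.
Qed.

Variables (e : I -> nat) (e_inj : injective e).

(* The coordinates outside the range of [e] carry a sign, so that they cancel on
   average. *)
Definition test_point (E : I -> C) (j : I) (b : bool) (l : nat) : C :=
  if [pick k | e k == l] is Some k then E k * U k j else (-1) ^+ b.

Lemma test_pointE E j b k : test_point E j b (e k) = E k * U k j.
Proof.
rewrite /test_point; case: pickP => [k' /eqP/e_inj -> //|/(_ k)].
by rewrite eqxx.
Qed.

Lemma test_point_unity E j b l : (forall k, E k ^+ 4 = 1) ->
  test_point E j b l ^+ 4 = 1.
Proof.
move=> E4; rewrite /test_point; case: pickP => [k _|_]; last first.
  by rewrite -exprM mulnC exprM -[4%N]/(2 * 2)%N exprM sqrrN !expr1n.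
by rewrite exprMn E4 mul1r -[4%N]/(2 * 2)%N exprM (bh_sign h) expr1n.
Qed.

Variables (K : nat) (c : I -> nat -> C).

(** The contribution of the z_i of the lifts: [c] holds their coefficients along the s_l, and each
    s_l is replaced by its value at the test point. *)
Definition test_value (E : I -> C) (j : I) (b : bool) : C :=
  \sum_i (walsh (fun k => E k * U k j) i)^* * \sum_(l < K) c i l * test_point E j b l.

(* The right-hand side does not depend on [E], which is what allows the two
   families of test points, for [E = 1] and [E = D], to be compared. *)
Lemma sum_test_value E : (forall l, normc (E l) = 1) ->
  \sum_j \sum_b test_value E j b =
  \sum_i \sum_(l < K) c i l * (if [pick k | e k == l] is Some k then U i k *+ 2 else 0).
Proof.
move=> E1; rewrite /test_value.
transitivity (\sum_i \sum_(l < K) c i l * \sum_j \sum_b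
    (walsh (fun k => E k * U k j) i)^* * test_point E j b l).
  under eq_bigr do rewrite exchange_big/=.
  rewrite exchange_big/=; apply: eq_bigr => i _.
  transitivity (\sum_j \sum_b \sum_(l < K) c i l *
     ((walsh (fun k => E k * U k j) i)^* * test_point E j b l)).
    apply: eq_bigr => j _; apply: eq_bigr => b _; rewrite mulr_sumr.
    by apply: eq_bigr => l _; ring.
  transitivity (\sum_j \sum_(l < K) \sum_b c i l *
     ((walsh (fun k => E k * U k j) i)^* * test_point E j b l)).
    by apply: eq_bigr => j _; exact: exchange_big.
  rewrite exchange_big/=; apply: eq_bigr => l _; rewrite mulr_sumr.
  by apply: eq_bigr => j _; rewrite mulr_sumr.
apply: eq_bigr => i _; apply: eq_bigr => l _; congr (_ * _).
(* On the range of [e], [walsh_dual] applies and the two values of [b] give the factor 2; off the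
   range they cancel. *)
rewrite /test_point; case: pickP => [k _|_].
  rewrite -(walsh_dual i k E1) -sumrMnl; apply: eq_bigr => j _.
  by rewrite big_bool/= mulr2n.
by rewrite big1// => j _; rewrite big_bool/= -mulrDr expr1 expr0 addNr mulr0.
Qed.

(** Both families have the same total by [sum_test_value], so a uniform upper bound on one dominates
    a uniform lower bound on the other. *)
Lemma test_value_le (x y : R) :
  (forall j b, complex.Re (test_value (fun=> 1) j b) <= x) ->
  (forall j b, y <= complex.Re (test_value D j b)) -> y <= x.
Proof.
move=> hx hy.
have D1 l : normc (D l) = 1 by apply: normc_unity4; rewrite (bh_unity h).
have e1 := sum_test_value (E := fun=> 1) (fun=> normc1 R).
have := sum_test_value D1; rewrite -{}e1 => e2.
have sumRe (F : I -> bool -> C) : complex.Re (\sum_j \sum_b F j b) =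
    \sum_j \sum_b complex.Re (F j b).
  rewrite raddf_sum.  by apply: eq_bigr => j _; rewrite raddf_sum.
have : \sum_(j : I) \sum_(b : bool) y <= \sum_(j : I) \sum_(b : bool) x.
  apply: (@le_trans _ _ (complex.Re (\sum_j \sum_b test_value D j b))).
    by rewrite sumRe; do 2 apply: ler_sum => ? _.
  by rewrite e2 sumRe; do 2 apply: ler_sum => ? _.
rewrite !sumr_const !card_bool -!mulrnA lerMn2r => /orP[|//].
by rewrite muln_eq0/= -leqn0 leqNgt n_gt0.
Qed.
End Walsh.

(** * Steinhaus variables *)

Section Steinhaus.
Context (R : realType) (d : measure_display) (T : measurableType d)
        (P : probability T R).
Local Notation C := R[i].

(** All test points have fourth roots of unity as coordinates, so four explicit angles suffice.
    Strictness in [t < 1] leaves room to the right of [t] inside [0, 1]. *)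
Lemma unity4_angle (z : C) : z ^+ 4 = 1 -> exists2 t : R, 0 <= t < 1 &
  cos (2 * pi * t) = complex.Re z /\ sin (2 * pi * t) = complex.Im z.
Proof.
have e0 : 2 * pi * 0 = 0 :> R by rewrite mulr0.
have e1 : 2 * pi * (1 / 4) = pi / 2 :> R by field.
have e2 : 2 * pi * (1 / 2) = pi :> R by field.
have e3 : 2 * pi * (3 / 4) = pi + pi / 2 :> R by field.
move=> /unity4_cases[]->.
- by exists 0; rewrite ?lexx ?ltr01// e0 cos0 sin0.
- by exists (1 / 2); [lra|rewrite e2 cospi sinpi /= oppr0].
- by exists (1 / 4); [lra|rewrite e1 cos_pihalf sin_pihalf].
- by exists (3 / 4); [lra|rewrite e3 cosDpihalf sinDpihalf sinpi cospi].
Qed.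

Definition cbox (z : C) (e : R) : set (R * R) :=
  ball (complex.Re z) e `*` ball (complex.Im z) e.

Lemma measurable_cbox z e : measurable (cbox z e).
Proof. by apply: measurableX; exact: measurable_ball. Qed.

(** By continuity the circle parametrisation stays in the box on an interval that starts at an angle
    of [z]. *)
Lemma cbox_gt0 (s : T -> C) (z : C) (e : R) : steinhaus P s -> z ^+ 4 = 1 -> 0 < e ->
  (0 < P ((cplane \o s) @^-1` cbox z e))%E.
Proof.
move=> [_ hs] z4 e0; rewrite hs; last exact: measurable_cbox.
have [t /andP[t0 t1] [ct st]] := unity4_angle z4.
pose f (u : R) := cos (2 * pi * u); pose g (u : R) := sin (2 * pi * u).
have cf : continuous f.
  move=> u; apply: continuous_comp; last exact: continuous_cos.
  by apply: continuousM; [exact: cvg_cst|exact: cvg_id].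
have cg : continuous g.
  move=> u; apply: continuous_comp; last exact: continuous_sin.
  by apply: continuousM; [exact: cvg_cst|exact: cvg_id].
have nf : nbhs t (f @^-1` ball (complex.Re z) e).
  by apply: cf; rewrite /f ct; exact: nbhsx_ballx.
have ng : nbhs t (g @^-1` ball (complex.Im z) e).
  by apply: cg; rewrite /g st; exact: nbhsx_ballx.
have /(nbhs_ballP t)[r /= r0 rfg] :
    nbhs t (f @^-1` ball (complex.Re z) e `&` g @^-1` ball (complex.Im z) e).
  exact: filterI.
(* The cut at 1 keeps the interval inside [0, 1], which carries the law. *)
pose q := Num.min (t + r) 1.
have tq : t < q by rewrite lt_min ltrDl r0.
have mfg : measurable (`[0, 1]%classic `&`
    (fun u : R => (cos (2 * pi * u), sin (2 * pi * u))) @^-1` cbox z e).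
  apply: measurableI; first exact: measurable_itv.
  apply: (@measurableI _ _ (f @^-1` ball (complex.Re z) e) (g @^-1` ball (complex.Im z) e)).
    rewrite -[X in measurable X]setTI; apply: (continuous_measurable_fun cf) => //.
    exact: measurable_ball.
  rewrite -[X in measurable X]setTI; apply: (continuous_measurable_fun cg) => //.
  exact: measurable_ball.
apply: (@lt_le_trans _ _ (lebesgue_measure `]t, q[%classic)).
  by rewrite lebesgue_measure_itv/= lte_fin tq -EFinD lte_fin subr_gt0.
apply: le_measure; rewrite ?inE//.
move=> u; rewrite /= in_itv/= => /andP[tu uq].
have [uq1 uq2] : u < t + r /\ u < 1 by move: uq; rewrite lt_min => /andP[].
split; first by rewrite in_itv/= (le_trans t0 (ltW tu)) ltW.
have [] := rfg u; last by move=> *; split.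
by rewrite /ball/= ltr0_norm ?subr_lt0// opprB ltrBlDl.
Qed.

(** The event |s| > 1 is the preimage of a Borel set that misses the unit circle. *)
Lemma steinhaus_le1 (s : T -> C) : steinhaus P s -> \forall w \ae P, normc (s w) <= 1.
Proof.
move=> [ms hs].
pose B : set (R * R) := (fun p => p.1 ^+ 2 + p.2 ^+ 2) @^-1` `]1, +oo[%classic.
have mB : measurable B.
  rewrite /B -[_ @^-1` _]setTI.
  have m : measurable_fun [set: R * R] (fun p : R * R => p.1 ^+ 2 + p.2 ^+ 2).
    by apply: measurable_funD; apply: measurable_funX.
  by apply: m => //; exact: measurable_itv.
exists ((cplane \o s) @^-1` B); split.
- by rewrite -[_ @^-1` _]setTI; exact: ms.
- rewrite hs// (_ : _ `&` _ = set0) ?measure0//.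
  by apply/seteqP; split => // t [_]; rewrite /B /= cos2Dsin2 in_itv/= ltxx.
- move=> w /= /negP; rewrite -ltNge /B /= in_itv/= andbT -normc_ReIm => h.
  by rewrite -(expr1n _ 2) ltr_pXn2r ?nnegrE ?ler01 ?normc_ge0.
Qed.

Variable s : nat -> T -> C.
Hypothesis s_steinhaus : forall n, steinhaus P (s n).
Hypothesis s_indep : mutually_independent P (fun n => cplane \o s n).

(** By independence the event of being close to [z] in the first [K] coordinates has positive
    probability, so it is not contained in the negligible set where [Q] fails. *)
Lemma steinhaus_support (K : nat) (z : nat -> C) (e : R) (Q : T -> Prop) :
  (forall l, z l ^+ 4 = 1) -> 0 < e -> (\forall w \ae P, Q w) ->
  exists2 w, Q w & forall l, (l < K)%N -> normc (s l w - z l) <= e.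
Proof.
move=> z4 e0 aeQ; apply: contrapT => hn.
(* Half of [e] for the real part and half for the imaginary part. *)
pose E := \bigcap_(l in [set` iota 0 K]) ((cplane \o s l) @^-1` cbox (z l) (e / 2)).
have mE : measurable E.
  apply: fin_bigcap_measurable => [|l _]; first exact: finite_seq.
  rewrite -[X in measurable X]setTI; apply: (s_steinhaus l).1 => //.
  exact: measurable_cbox.
have : (0 < P E)%E.
  rewrite (s_indep (B := fun l => cbox (z l) (e / 2))) ?iota_uniq//; last first.
    by move=> l; exact: measurable_cbox.
  apply: (big_ind (fun x => 0 < x)%E); [exact: lte01|exact: mule_gt0|].
  by move=> l _; apply: cbox_gt0 => //; rewrite divr_gt0.
rewrite (measure_negligible mE) ?ltxx//.
apply: negligibleS aeQ => w Ew Qw; apply: hn; exists w => // l lK.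
have [] : cbox (z l) (e / 2) (cplane (s l w)) by apply: Ew; rewrite /= mem_iota.
rewrite /ball/= => h1 h2; apply: le_trans (normc_le_ReIm _) _.
rewrite [e]splitr lerD// ltW//.
  by move: h1; rewrite distrC; case: (s l w) (z l) => ? ? [].
by move: h2; rewrite distrC; case: (s l w) (z l) => ? ? [].
Qed.
End Steinhaus.

(** * Columns and amalgamated sums *)

Section OperatorSpaceTools.
Variable R : realType.
Local Notation C := R[i].

(** A multiple of [T] is a contraction, hence completely contractive from [min_opspace V] into the
    minimal space; the completely bounded inverse [S] leads back to [OV]. *)
Lemma minimal_iso_bound (V W : normedModType C) (OV : opspace V) (OW : opspace W) :
  minimal_opspace OW -> completely_isomorphic OV OW ->
  exists M : R, forall n (x : 'M[V]_n), mnorm OV x <= M * mnorm (min_opspace V) x.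
Proof.
move=> mW [T [S [TS _ [M hM] [N hN]]]].
(* The constants [M] and [N] may be nonpositive: [M'] has to be invertible, and [N] is replaced by
   its maximum with 0 below. *)
pose M' := Num.max M 1.
have M'0 : 0 < M' by rewrite lt_max ltr01 orbT.
pose c : C := (M'^-1)%:C.
have nc : normc c = M'^-1 by rewrite normc_real ger0_norm// invr_ge0 ltW.
have T1 v : rnorm (T v) <= M * rnorm v.
  have := hM 1%N (const_mx v); rewrite !mnorm1 !mxE; exact.
have T'1 : Defs.contraction (c \*: T).
  move=> v; rewrite /= rnormZ nc mulrC ler_pdivrMr//.
  apply: le_trans (T1 v) _; rewrite mulrC ler_wpM2l ?rnorm_ge0//.
  by rewrite le_max lexx.
exists (Num.max N 0 * M') => n x.
have := mW _ (min_opspace V) (c \*: T) T'1 n x.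
rewrite (_ : map_mx (c \*: T) x = map_mx ( *:%R c) (map_mx T x)); last first.
  by apply/matrixP => i j; rewrite !mxE.
rewrite mnormZ nc mulrC ler_pdivrMr// => hT.
have := hN _ (map_mx T x); rewrite (_ : map_mx S (map_mx T x) = x); last first.
  by apply/matrixP => i j; rewrite !mxE TS.
move=> /le_trans; apply.
apply: (@le_trans _ _ (Num.max N 0 * mnorm OW (map_mx T x))).
  by rewrite ler_wpM2r ?mnorm_ge0// le_max lexx.
by rewrite -mulrA ler_wpM2l ?le_max ?lexx ?orbT// mulrC.
Qed.

Variables (V : normedModType C) (I : finType) (j0 : 'I_#|I|).

(** Matrix norms live on square matrices only, so the column is padded with zeros. *)
Definition column (q : I -> V) : 'M[V]_#|I| :=
  \matrix_(i, j) if j == j0 then q (enum_val i) else 0.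

Let sum_enum (A : nmodType) (F : I -> A) :
  \sum_(k < #|I|) F (enum_val k) = \sum_i F i.
Proof. exact/esym/(reindex _ (onW_bij _ (enum_val_bij I))). Qed.

(** The right vector [b] enters only through its entry at [j0], of modulus at most 1. *)
Lemma min_column_le (q : I -> V) (M : R) :
  (forall a : I -> C, \sum_i normc (a i) ^+ 2 <= 1 ->
     rnorm (\sum_i a i *: q i) <= M) ->
  mnorm (min_opspace V) (column q) <= M.
Proof.
move=> h; have M0 : 0 <= M.
  apply: le_trans (h (fun=> 0) _); rewrite ?rnorm_ge0//.
  by rewrite big1 ?ler01// => i _; rewrite normc0 expr0n.
apply: ge_sup.
  by exists (rnorm (mxact (0 : 'rV_#|I|) (column q) (0 : 'cV_#|I|) ord0 ord0)), 0, 0;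
    rewrite !l2norm0 ler01.
move=> _ [a [b [a1 b1 ->]]].
have -> : mxact a (column q) b ord0 ord0 =
    b j0 ord0 *: \sum_i a ord0 (enum_rank i) *: q i.
  rewrite mxE -sum_enum scaler_sumr; apply: eq_bigr => k _.
  rewrite (bigD1 j0)//= big1 ?addr0 => [|j jj0]; last first.
    by rewrite mxE (negPf jj0) scaler0.
  by rewrite mxE eqxx enum_valK mulrC scalerA.
rewrite rnormZ -[leRHS]mul1r ler_pM ?normc_ge0 ?rnorm_ge0//.
  rewrite -(@expr_le1 _ 2) ?normc_ge0//.
  move: b1; rewrite -(@expr_le1 _ 2 (l2norm b)) ?l2norm_ge0// sqr_l2norm; apply: le_trans.
  rewrite (bigD1 j0)//= big_ord1 lerDl.
  by apply: sumr_ge0 => k _; apply: sumr_ge0 => ? _; rewrite sqr_ge0.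
apply: h; move: a1; rewrite -(@expr_le1 _ 2 (l2norm a)) ?l2norm_ge0// sqr_l2norm big_ord1.
apply: le_trans; rewrite -sum_enum.
by apply: ler_sum => k _; rewrite enum_valK.
Qed.

(** Compression by the row [a] on the left and a unit vector on the right does not increase the
    norm. *)
Lemma mnorm_column_ge (O : opspace V) (x : 'M[V]_#|I|) (a : I -> C) :
  \sum_i normc (a i) ^+ 2 <= 1 ->
  rnorm (\sum_i a i *: x (enum_rank i) j0) <= mnorm O x.
Proof.
move=> a1; pose u : 'rV[C]_#|I| := \row_k a (enum_val k).
have := mnorm_act O u x (delta_mx j0 ord0).
rewrite mnorm1 (_ : mxact _ _ _ ord0 ord0 = \sum_i a i *: x (enum_rank i) j0).
  move=> /le_trans; apply; rewrite mulrAC ler_piMl ?mnorm_ge0//.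
  rewrite mulr_ile1 ?opnorm_ge0 ?opnorm_delta//.
  apply: le_trans (opnorm_le_l2 _) _; apply: l2norm_le => //.
  rewrite big_ord1 expr1n; apply: le_trans a1; rewrite -sum_enum.
  by apply: ler_sum => k _; rewrite mxE.
rewrite mxE -sum_enum; apply: eq_bigr => k _.
rewrite (bigD1 j0)//= big1 ?addr0 => [|j jj0]; last first.
  by rewrite !mxE (negPf jj0) mulr0 scale0r.
by rewrite !mxE !eqxx mulr1 enum_valK.
Qed.
End OperatorSpaceTools.

Lemma cquot_mx_surj (R : realType) (V : normedModType R[i]) (W : closed_submodule V) n
    (q : 'M[cquot W]_n) : exists v, map_mx (@cquot_pi _ V W) v = q.
Proof.
have /choice[f fK] := @cquot_pi_surj _ V W.
by exists (map_mx f q); apply/matrixP => i j; rewrite !mxE.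
Qed.

Section Amalgam.
Variables (R : realType) (E : normedModType R[i]) (O : opspace E).
Variable Z : closed_submodule E.

Lemma rnorm_pair (u v : E) :
  rnorm ((u, v) : (E * E)%type) = Num.max (rnorm u) (rnorm v).
Proof.
apply: complexI; rewrite rnormE [LHS]prod_normE /= -!rnormE.
by rewrite /Order.max ltcR; case: ifP.
Qed.

Lemma mem_csubmodP (v : E) :
  v \in Z <-> forall e : R, 0 < e -> exists2 y, y \in Z & rnorm (v - y) < e.
Proof.
split=> [vZ e e0|h]; first by exists v; rewrite // subrr rnorm0.
suff : closure [set y | y \in (Z : submodule E)] v.
  by rewrite -(closure_id _).1//; exact: csubmod_closed.
exact/submod_rnormP.
Qed.

Let W := amalg_sub (sub_incl O Z) (sub_incl O Z).

(** The spanning pairs have first coordinate in [Z], and this survives the closure because [Z] is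
    closed. *)
Lemma amalg_sub_fst (p : (E * E)%type) : p \in W -> p.1 \in Z.
Proof.
move=> pW; apply/mem_csubmodP => e e0.
have /submod_rnormP : closure [set x | x \in lspan_submod
    (range (fun z : csubmod_type Z => (sub_incl O Z z, - sub_incl O Z z)))] p.
  move: pW => /asboolP; rewrite (_ : lspan _ = [set x | x \in lspan_submod
    (range (fun z : csubmod_type Z => (sub_incl O Z z, - sub_incl O Z z)))])//.
  by apply/seteqP; split => x /asboolP.
move=> /(_ e e0)[y /asboolP[n [c [a [ha ->]]]] py].
exists (\sum_i c i *: (a i).1).
  apply: rpred_sum => i _; apply: rpredZ.
  by have [z _ <-] := ha i; exact: (valP (z : submod_type Z)).
apply: le_lt_trans py; rewrite [p - _]surjective_pairing rnorm_pair le_max.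
by rewrite [X in _ <= X](_ : _ = rnorm (p.1 - \sum_i c i *: (a i).1)) ?lexx//= raddf_sum.
Qed.

Lemma antidiag_mem_amalg_sub (z : E) : z \in Z -> (z, - z) \in W.
Proof.
move=> zZ; apply/asboolP; apply: subset_closure.
exists 1%N, (fun=> 1), (fun=> (z, - z)); split; last by rewrite big_ord1 scale1r.
by move=> _; exists (exist _ z zZ : csubmod_type Z).
Qed.

(** Modulo (z, -z), the pair (x, -x) equals (x - z, -(x - z)), both of whose coordinates have the
    norm of x - z. *)
Lemma amalg_antidiag_le (x z : E) : z \in Z ->
  rnorm (cquot_pi W (x, - x)) <= rnorm (x - z).
Proof.
move=> zZ; rewrite cquot_normE.
have -> : cquot_pi W (x, - x) = cquot_pi W (x - z, - (x - z)).
  apply/lquot_eq; rewrite (_ : _ - _ = (z, - z)) ?antidiag_mem_amalg_sub//.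
  by congr pair; rewrite /= ?opprK ?addKr// opprB addrCA subrr addr0.
apply: le_trans (infnorm_le _ _ _) _; [exact: cquot_pi_surj|exact: rnorm_ge0|].
by rewrite rnorm_pair /rnorm normrN maxxx.
Qed.
End Amalgam.

(** * Essentially bounded functions *)

Section Span.
Variables (K : nzRingType) (V : lmodType K) (f : nat -> V).

(** Asking this for all large [N] lets finitely many vectors share one number of terms. *)
Definition tail_comb (v : V) (c : nat -> K) (m : nat) :=
  forall N, (m <= N)%N -> v = \sum_(l < N) c l *: f l.

Lemma lspan_range v : lspan (range f) v -> exists c m, tail_comb v c m.
Proof.
move=> [n [c [a [ha ->]]]].
apply: (big_ind (fun v => exists c m, tail_comb v c m)).
- by exists (fun=> 0), 0%N => N _; rewrite big1// => l _; rewrite scale0r.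
- move=> u w [cu [mu hu]] [cw [mw hw]].
  exists (fun l => cu l + cw l), (maxn mu mw) => N; rewrite geq_max => /andP[uN wN].
  rewrite [in LHS](hu N uN) [in LHS](hw N wN) -big_split/=.
  by apply: eq_bigr => l _; rewrite scalerDl.
- move=> i _; have [k _ <-] := ha i.
  exists (fun l => (l == k)%:R * c i), k.+1 => N kN.
  rewrite (bigD1 (Ordinal kN))//= eqxx mul1r big1 ?addr0// => l lk.
  by rewrite (_ : (l == k :> nat) = false) ?mul0r ?scale0r//; apply/negbTE.
Qed.

Lemma lspan_range_fin (I : finType) (v : I -> V) :
  (forall i, lspan (range f) (v i)) ->
  exists (c : I -> nat -> K) m, forall i, v i = \sum_(l < m) c i l *: f l.
Proof.
move=> h; have /choice[c /choice[m hm]] := fun i => lspan_range (h i).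
by exists c, (\max_i m i) => i; apply: hm; exact: leq_bigmax.
Qed.
End Span.

Section LinfTools.
Context (R : realType) (d : measure_display) (T : measurableType d)
        (P : probability T R).
Local Notation C := R[i].
Local Notation L := (Linf P).
Implicit Types (u v : L).

Lemma Linf_rnormE u : rnorm u = Linf_rnorm u.
Proof. by []. Qed.

Lemma Linf_reprB u v :
  \forall w \ae P, Linf_repr (u - v) w = Linf_repr u w - Linf_repr v w.
Proof.
rewrite -scaleN1r; apply: filterS2 (Linf_reprD u (-1 *: v)) (Linf_reprZ (-1) v).
by move=> w -> ->; rewrite mulN1r.
Qed.

Lemma Linf_repr_comb (J : finType) (c : J -> C) (u : J -> L) :
  \forall w \ae P, Linf_repr (\sum_j c j *: u j) w = \sum_j c j * Linf_repr (u j) w.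
Proof.
elim: (index_enum J) => [|j r IH].
  by rewrite big_nil; apply: filterS (Linf_repr0 P) => w ->; rewrite big_nil.
rewrite big_cons.
apply: filterS3 IH (Linf_reprD (c j *: u j) (\sum_(i <- r) c i *: u i)) 
  (Linf_reprZ (c j) (u j)) => w.
by move=> IH -> ->; rewrite big_cons IH.
Qed.

Lemma Linf_xlog_subproof u : (fun w => xlog (Linf_repr u w)) \in Linf_fun P.
Proof.
have /asboolP[mu _] := Linf_reprP u.
have [mu1 mu2] := (measurable_fun_pairP _).1 mu.
apply/asboolP; split.
  have ml : measurable_fun [set: T] (fun w => ln (normc (Linf_repr u w))).
    apply: measurableT_comp => //.
    rewrite (_ : (fun w => _) = fun w => Num.sqrt (complex.Re (Linf_repr u w) ^+ 2
        + complex.Im (Linf_repr u w) ^+ 2)); last first.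
      by apply/funext => w; case: (Linf_repr u w).
    apply: measurableT_comp.
      by apply: continuous_measurable_fun; exact: sqrt_continuous.
    by apply: measurable_funD; apply: measurable_funX.
  apply/measurable_fun_pairP; split.
    rewrite (_ : _ \o _ = fun w => ln (normc (Linf_repr u w)) * complex.Re (Linf_repr u w)).
      exact: measurable_funM.
    by apply/funext => w; rewrite /xlog/=; case: (Linf_repr u w) => a b /=; rewrite mul0r subr0.
  rewrite (_ : _ \o _ = fun w => ln (normc (Linf_repr u w)) * complex.Im (Linf_repr u w)).
    exact: measurable_funM.
  by apply/funext => w; rewrite /xlog/=; case: (Linf_repr u w) => a b /=; rewrite mul0r addr0.
(* Essential boundedness comes from [normc_xlog]. *)
apply: (@le_lt_trans _ _ (Linf_rnorm u ^+ 2 + 1)%:E); last by rewrite ltry.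
apply/ess_supP; apply: filterS (Linf_rnorm_ae u) => w hw; rewrite lee_fin.
apply: le_trans (normc_xlog _) _; rewrite lerD2r.
by rewrite ler_pXn2r ?nnegrE ?normc_ge0// (le_trans (normc_ge0 _) hw).
Qed.

Definition Linf_xlog u : L := Linf_class (Linf_xlog_subproof u).

Lemma Linf_xlogE u : \forall w \ae P, Linf_repr (Linf_xlog u) w = xlog (Linf_repr u w).
Proof. exact: Linf_classK. Qed.
End LinfTools.

(** * The contribution of the twisted vectors at the two families of test points *)

Section Core.
Variables (R : realType) (I : finType).
Local Notation C := R[i].
Local Notation n := #|I|.
Variables (U : I -> I -> C) (D : I -> C).
Hypotheses (h : bent_hadamard U D) (n_gt0 : (0 < n)%N).
Local Notation walsh := (walsh U).

(** The coefficients of a column of [U] form a basis vector, so a single term survives, and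
    [normc_xlog] bounds it by 1 + 1. *)
Lemma xlog_row_le (t : I -> C) j : (forall k, normc (t k) <= 1) ->
  normc (\sum_i (walsh (fun k => 1 * U k j) i)^* * xlog (walsh t i)) <= 2.
Proof.
move=> t1; have -> : (fun k => 1 * U k j) = U^~ j by apply/funext => k; rewrite mul1r.
rewrite (bigD1 j)//= big1 ?addr0 => [|i ij]; last first.
  by rewrite (walsh_row h n_gt0) (negPf ij) rmorph0 mul0r.
rewrite (walsh_row h n_gt0) eqxx rmorph1 mul1r.
apply: le_trans (normc_xlog _) _; rewrite [leRHS](natrD _ 1 1) lerD2r.
by rewrite exprn_ile1 ?normc_ge0// (walsh_le1 h n_gt0).
Qed.

(** Since [z] is within r / 2 of [v], the real part of conj(v) z is at least r^2 / 2 and |z| <= 2r,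
    so ln |z| <= ln (2r) <= 0. *)
Lemma xlog_near_le (v z : C) (r : R) : 0 < r -> r *+ 2 <= 1 -> normc v = r ->
  normc (z - v) <= r / 2 -> complex.Re (v^* * xlog z) <= r ^+ 2 / 2 * ln (r *+ 2).
Proof.
move=> r0 r1 vr zv.
have l0 : ln (r *+ 2) <= 0 by apply: ln_le0.
have re : r ^+ 2 / 2 <= complex.Re (v^* * z).
  have -> : v^* * z = (r ^+ 2)%:C + v^* * (z - v).
    by rewrite mulrBr mulcJ_normc vr addrC subrK.
  have : `|complex.Re (v^* * (z - v))| <= r * (r / 2).
    apply: le_trans (ler_Re_normc _) _; rewrite normcM normc_conj vr.
    by rewrite ler_wpM2l// ltW.
  rewrite raddfD/= ler_norml => /andP[+ _]; lra.
have zr : normc z <= r *+ 2.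
  have := le_normcD (z - v) v; rewrite subrK vr => /le_trans; apply.
  by rewrite mulr2n lerD2r (le_trans zv)// ler_pdivrMr// ler_peMr ?ltW// ltr1n.
have z0 : 0 < normc z.
  have := le_normcD (v - z) z; rewrite subrK vr => hv.
  have : normc (v - z) <= r / 2 by rewrite -opprB normcN.
  lra.
have lz : ln (normc z) <= ln (r *+ 2) by rewrite ler_ln ?posrE// pmulrn_lgt0.
rewrite /xlog mulrCA.
have -> : complex.Re ((ln (normc z))%:C * (v^* * z)) = ln (normc z) * complex.Re (v^* * z).
  by case: (v^* * z) => a b /=; rewrite mul0r subr0.
have re0 : 0 <= complex.Re (v^* * z) by apply: le_trans re; rewrite divr_ge0// sqr_ge0.
apply: le_trans (ler_wpM2r re0 lz) _.
by rewrite mulrC ler_wnM2r.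
Qed.

(** All n coefficients have modulus r = n^(-1/2), and each of the n terms is at most r^2 / 2 times
    ln (2r). *)
Lemma xlog_bent_le (t : I -> C) j (r : R) : 0 < r -> r *+ 2 <= 1 ->
  r ^+ 2 = n%:R^-1 -> (forall k, normc (t k - D k * U k j) <= r / 2) ->
  complex.Re (\sum_i (walsh (fun k => D k * U k j) i)^* * xlog (walsh t i)) <=
  ln (r *+ 2) / 2.
Proof.
move=> r0 r1 rn ht; rewrite raddf_sum/=.
apply: (@le_trans _ _ (\sum_(i : I) r ^+ 2 / 2 * ln (r *+ 2))).
  apply: ler_sum => i _; apply: xlog_near_le => //.
    apply/eqP; rewrite -(@eqrXn2 _ 2) ?normc_ge0// ?ltW//.
    by rewrite (walsh_bent h n_gt0) rn.
  exact: (walsh_dist h n_gt0).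
rewrite sumr_const -[leLHS]mulr_natl rn !mulrA mulfV ?mul1r 1?mulrC//.
by rewrite pnatr_eq0 -lt0n.
Qed.
End Core.

(** * The lower bound *)

Section Main.
Context (R : realType) (d : measure_display) (T : measurableType d)
        (P : probability T R).
Local Notation C := R[i].
Variable s : nat -> T -> C.
Hypothesis s_steinhaus : forall n, steinhaus P (s n).
Hypothesis s_indep : mutually_independent P (fun n => cplane \o s n).
Variable I : finType.
Local Notation n := #|I|.
Variables (U : I -> I -> C) (D : I -> C).
Hypotheses (h : bent_hadamard U D) (n_gt0 : (0 < n)%N).

Definition sclass l : Linf P := Linf_class (steinhaus_Linf (s_steinhaus l)).
Definition sspan := clspan (range sclass).

Let e (k : I) : nat := enum_rank k.
Let e_inj : injective e.
Proof. by move=> k l /val_inj/enum_rank_inj. Qed.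

Definition walsh_sum (i : I) : Linf P := \sum_k (n%:R^-1 * U i k) *: sclass (e k).

Lemma sclass_ae l : \forall w \ae P, Linf_repr (sclass l) w = s l w.
Proof. exact: Linf_classK. Qed.

Lemma sclass_mem l : sclass l \in sspan.
Proof.
apply/asboolP/subset_closure; exists 1%N, (fun=> 1), (fun=> sclass l).
by split; [move=> _; exists l|rewrite big_ord1 scale1r].
Qed.

Lemma walsh_sum_mem i : walsh_sum i \in sspan.
Proof. by apply: rpred_sum => k _; apply: rpredZ; exact: sclass_mem. Qed.

Lemma walsh_sum_ae : \forall w \ae P, forall i,
  Linf_repr (walsh_sum i) w = walsh U (fun k => s (e k) w) i.
Proof.
apply: filter_forall => i.
have hs : \forall w \ae P, forall k, Linf_repr (sclass (e k)) w = s (e k) w.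
  by apply: filter_forall => k; exact: sclass_ae.
apply: filterS2 hs (Linf_repr_comb (fun k => n%:R^-1 * U i k) (fun k => sclass (e k))).
move=> w hw ->; rewrite /walsh mulr_sumr; apply: eq_bigr => k _.
by rewrite hw mulrA.
Qed.

Lemma steinhaus_all_le1 : \forall w \ae P, forall k : I, normc (s (e k) w) <= 1.
Proof. by apply: filter_forall => k; exact: steinhaus_le1. Qed.

(** Each term of the difference is a_i g_i (ln |g_i| - ln |a_i|), which [mulM_ln_le] controls; the
    square sums of the a_i and of the g_i are at most 1. *)
Lemma xlog_comb_near (a : I -> C) : \sum_i normc (a i) ^+ 2 <= 1 ->
  exists2 z, z \in sspan & rnorm (\sum_i a i *: Linf_xlog (walsh_sum i) - z) <= 2.
Proof.
move=> a1; exists (\sum_i xlog (a i) *: walsh_sum i).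
  by apply: rpred_sum => i _; apply: rpredZ; exact: walsh_sum_mem.
rewrite Linf_rnormE; apply: Linf_rnorm_le.
have hx : \forall w \ae P, forall i,
    Linf_repr (Linf_xlog (walsh_sum i)) w = xlog (Linf_repr (walsh_sum i) w).
  by apply: filter_forall => i; exact: Linf_xlogE.
have ha := Linf_repr_comb a (fun i => Linf_xlog (walsh_sum i)).
have hb := Linf_repr_comb (fun i => xlog (a i)) walsh_sum.
have hab := Linf_reprB (\sum_i a i *: Linf_xlog (walsh_sum i))
  (\sum_i xlog (a i) *: walsh_sum i).
apply: filterS3 (filterI hx (filterI ha hb)) (filterI walsh_sum_ae steinhaus_all_le1)
  hab => w [hxw [haw hbw]] [hww s1] ->.
rewrite haw hbw -sumrB; apply: le_trans (normc_sum _ _) _.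
set g := walsh U (fun k => s (e k) w).
apply: (@le_trans _ _ (\sum_i (normc (a i) ^+ 2 + normc (g i) ^+ 2))).
  apply: ler_sum => i _; rewrite hxw hww -/(g i) /xlog.
  have -> : a i * ((ln (normc (g i)))%:C * g i) - (ln (normc (a i)))%:C * a i * g i =
      a i * g i * (ln (normc (g i)) - ln (normc (a i)))%:C by rewrite rmorphB/=; ring.
  rewrite normcM (normcM (a i)) normc_real distrC.
  by apply: mulM_ln_le; exact: normc_ge0.
rewrite big_split/= [leRHS](natrD _ 1 1) lerD//.
exact: (walsh_sum_sqr_le1 h n_gt0).
Qed.

Variables (p : I -> Linf P) (M : R).
Hypothesis p_near : forall i, p i - Linf_xlog (walsh_sum i) \in sspan.
Hypothesis p_le : forall a : I -> C, \sum_i normc (a i) ^+ 2 <= 1 ->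
  rnorm (\sum_i a i *: p i) <= M.

(** The bound [M] on the lifts is read off at a sample point near the test point. The extra 2 pays
    for truncating the z_i to finite combinations and for replacing the s_l by the test values. [K]
    and [c] are fixed before [E], so they serve both families. *)
Lemma test_value_near (e0 : R) : 0 < e0 -> exists K (c : I -> nat -> C),
  forall E j b, (forall k, E k ^+ 4 = 1) -> exists t : I -> C,
  [/\ forall k, normc (t k) <= 1,
      forall k, normc (t k - E k * U k j) <= e0 &
      normc (test_value U e K c E j b +
        \sum_i (walsh U (fun k => E k * U k j) i)^* * xlog (walsh U t i)) <= M + 2].
Proof.
move=> e0_gt0.
have nR : 0 < n%:R^-1 :> R by rewrite invr_gt0 ltr0n.
(* Precision 1 / n, so that the n truncation errors add up to at most 1. *)
have /choice[y hy] : forall i, exists y, lspan (range sclass) y /\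
    rnorm (p i - Linf_xlog (walsh_sum i) - y) < n%:R^-1.
  move=> i; have /asboolP := p_near i.
  have -> : closure (lspan (range sclass)) =
      closure [set x | x \in lspan_submod (range sclass)].
    by congr closure; apply/seteqP; split => x /asboolP.
  by move=> /submod_rnormP/(_ _ nR)[y /asboolP ys yd]; exists y.
have [c [K yE]] := lspan_range_fin (fun i => (hy i).1).
exists K, c => E j b E4.
have E1 k : normc (E k) = 1 by apply: normc_unity4.
set v := walsh U (fun k => E k * U k j).
have U1 k : normc (E k * U k j) = 1 by rewrite normcM E1 (bh_norm h) mulr1.
have v1 : \sum_i normc (v i)^* ^+ 2 <= 1.
  under eq_bigr do rewrite normc_conj.
  by apply: (walsh_sum_sqr_le1 h n_gt0) => k; rewrite U1.
have vi i : normc (v i)^* <= 1.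
  by rewrite normc_conj; apply: (walsh_le1 h n_gt0) => k; rewrite U1.
pose S := \sum_i \sum_(l < K) normc (c i l).
have S0 : 0 <= S by do 2 apply: sumr_ge0 => ? _; exact: normc_ge0.
(* The second bound keeps the replacement error below S / (S + 1), hence below 1. *)
pose e1 := Num.min e0 (S + 1)^-1.
have S1 : 0 < S + 1 by rewrite ltr_wpDl.
have e1_gt0 : 0 < e1 by rewrite lt_min e0_gt0 invr_gt0.
have hx : \forall w \ae P, forall i,
    Linf_repr (Linf_xlog (walsh_sum i)) w = xlog (Linf_repr (walsh_sum i) w).
  by apply: filter_forall => i; exact: Linf_xlogE.
have hp : \forall w \ae P, normc (\sum_i (v i)^* * Linf_repr (p i) w) <= M.
  apply: filterS2 (Linf_repr_comb (fun i => (v i)^*) p)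
    (Linf_rnorm_ae (\sum_i (v i)^* *: p i)) => w <- /le_trans; apply.
  by rewrite -Linf_rnormE p_le.
have hy' : \forall w \ae P, forall i,
    normc (Linf_repr (p i) w - Linf_repr (Linf_xlog (walsh_sum i)) w -
           \sum_(l < K) c i l * s l w) <= n%:R^-1.
  apply: filter_forall => i.
  have hs : \forall w \ae P, forall l : 'I_K, Linf_repr (sclass l) w = s l w.
    by apply: filter_forall => l; exact: sclass_ae.
  have := Linf_repr_comb (fun l : 'I_K => c i l) (fun l : 'I_K => sclass l).
  rewrite -yE => hyi.
  have hB1 := Linf_reprB (p i) (Linf_xlog (walsh_sum i)).
  have hB2 := Linf_reprB (p i - Linf_xlog (walsh_sum i)) (y i).
  apply: filterS3 (filterI hs hyi) (Linf_rnorm_ae (p i - Linf_xlog (walsh_sum i) - y i))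
    (filterI hB1 hB2) => w [hsw hyw] hw [e1w e2w].
  rewrite e2w e1w hyw in hw.
  under eq_bigr do rewrite -hsw.
  by apply: le_trans hw _; rewrite -Linf_rnormE ltW// (hy i).2.
(* Up to [maxn K n] one meets the variables of the truncations and those of the [walsh_sum i]. *)
have [w [[s1 hww] [hxw [hpw hyw]]] ws] :=
  steinhaus_support s_steinhaus s_indep (maxn K n) (z := test_point U e E j b)
    (fun l => test_point_unity h e j b l E4) e1_gt0
    (filterI (filterI steinhaus_all_le1 walsh_sum_ae) (filterI hx (filterI hp hy'))).
exists (fun k => s (e k) w); split => // [k|].
  have := ws (e k); rewrite (test_pointE U e_inj).
  have -> : (e k < maxn K n)%N by rewrite leq_max ltn_ord orbT.
  by move=> /(_ isT)/le_trans; apply; rewrite ge_min lexx.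
rewrite /test_value -/v -big_split/=.
set g := walsh U (fun k => s (e k) w).
pose f i := Linf_repr (p i) w.
(* Each term is the lift term minus the truncation error and the replacement error, which are then
   estimated separately. *)
rewrite (eq_bigr (fun i => (v i)^* * f i - ((v i)^* * (f i - xlog (g i) -
    \sum_(l < K) c i l * s l w) + (v i)^* * \sum_(l < K) c i l * (s l w -
      test_point U e E j b l)))); last first.
  move=> i _; have -> : \sum_(l < K) c i l * (s l w - test_point U e E j b l) =
      \sum_(l < K) c i l * s l w - \sum_(l < K) c i l * test_point U e E j b l.
    by rewrite -sumrB; apply: eq_bigr => l _; rewrite mulrBr.
  ring.
rewrite sumrB; apply: le_trans (le_normcD _ _) _; rewrite normcN lerD//.
rewrite big_split/= [leRHS](natrD _ 1 1).
apply: le_trans (le_normcD _ _) _; apply: lerD.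
  apply: le_trans (normc_sum _ _) _; apply: (@le_trans _ _ (\sum_(i : I) n%:R^-1)).
    apply: ler_sum => i _; rewrite normcM -[leRHS]mul1r ler_pM ?normc_ge0//.
    by have := hyw i; rewrite hxw hww.
  by rewrite sumr_const -[leLHS]mulr_natl mulfV// gt_eqF// ltr0n.
apply: le_trans (normc_sum _ _) _.
apply: (@le_trans _ _ (S * (S + 1)^-1)).
  rewrite mulr_suml; apply: ler_sum => i _.
  rewrite normcM -[leRHS]mul1r ler_pM ?normc_ge0//.
  apply: le_trans (normc_sum _ _) _; rewrite mulr_suml; apply: ler_sum => l _.
  rewrite normcM ler_wpM2l ?normc_ge0//.
  apply: le_trans (ws l _) _; first by rewrite leq_max ltn_ord.
  by rewrite ge_min lexx orbT.
by rewrite ler_pdivrMr// mul1r lerDl.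
Qed.

(** For [E = 1] the real part of the test value is at most (M + 2) + 2; for [E = D] it is at least
    the left-hand side. [test_value_le] compares the two. *)
Lemma lift_lower (r : R) : 0 < r -> r *+ 2 <= 1 -> r ^+ 2 = n%:R^-1 ->
  - (M + 2) - ln (r *+ 2) / 2 <= M + 4.
Proof.
move=> r0 r1 rn.
(* The precision r / 2 is the one that [xlog_bent_le] asks for. *)
have [|K [c hc]] := @test_value_near (r / 2); first by rewrite divr_gt0.
apply: (test_value_le h n_gt0 (K := K) (c := c) (e := e)) => j b.
  have [k|t [t1 _]] := hc (fun=> 1) j b; first by rewrite expr1n.
  have := xlog_row_le h n_gt0 j t1.
  set S := \sum_i _; set V := test_value _ _ _ _ _ _ _ => hS hV.
  have -> : V = (V + S) - S by rewrite addrK.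
  rewrite raddfB/=.
  have := ler_Re_normc (V + S); have := ler_Re_normc S.
  rewrite !ler_norml => /andP[? ?] /andP[? ?]; lra.
have [|t [t1 t2]] := hc D j b; first exact: (bh_unity h).
have := xlog_bent_le h n_gt0 r0 r1 rn t2.
set S := \sum_i _; set V := test_value _ _ _ _ _ _ _ => hS hV.
have -> : V = (V + S) - S by rewrite addrK.
rewrite raddfB/=.
have := ler_Re_normc (V + S).
rewrite !ler_norml => /andP[? ?]; lra.
Qed.
End Main.

(** * The contradiction for large Hadamard matrices *)

Theorem theorem5p1 (R : realType) (d : measure_display) (T : measurableType d)
    (P : probability T R) (s : nat -> T -> R[i])
    (s_steinhaus : forall n, steinhaus P (s n))
    (s_indep : mutually_independent P (fun n => cplane \o s n)) :
  let X := MIN (Linf P) in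
  let Z := clspan
    (range (fun n => Linf_class (steinhaus_Linf (s_steinhaus n)))) in
  ~ (exists (W : normedModType R[i]) (OW : opspace W),
       minimal_opspace OW /\
       completely_isomorphic (amalg_sum (sub_incl X Z) (sub_incl X Z)) OW).
Proof.
move=> X Z [W [OW [mW iso]]].
have [M0 hM0] := minimal_iso_bound mW iso.
(* The column has minimal norm at most 2; the added 1 makes the bound strict, so that some lift has
   norm below [M]. *)
pose M := Num.max M0 0 * 2 + 1.
(* With 2r = 2^(-m), [lift_lower] reads m ln 2 <= 4M + 12. *)
have [m hm] : exists m, 4 * M + 12 < m%:R * ln (2 : R).
  have l2 : 0 < ln (2 : R) by rewrite ln_gt0// ltr1n.
  exists (Num.truncn ((4 * M + 12) / ln 2)).+1.
  by rewrite -ltr_pdivrMr// truncnS_gt.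
(* The order is 4^(m+1), a perfect square, so that n^(-1/2) = 2^(-(m+1)). *)
have [I [U [D [cI h]]]] := exists_bent_hadamard R (m + m).+1.
have n_gt0 : (0 < #|I|)%N by rewrite cI expn_gt0.
pose r : R := (2 ^+ m.+1)^-1.
have r2 : r *+ 2 = (2 ^+ m)^-1.
  by rewrite /r exprS invfM -[LHS]mulr_natr mulrAC mulVf ?mul1r// pnatr_eq0.
have r0 : 0 < r by rewrite invr_gt0 exprn_gt0.
have r1 : r *+ 2 <= 1 by rewrite r2 invf_le1 ?exprn_gt0// exprn_ege1// ler1n.
have rn : r ^+ 2 = #|I|%:R^-1.
  by rewrite cI natrX /r exprVn -exprM mulnC mul2n -addnn addSn addnS.
pose j0 : 'I_#|I| := Ordinal n_gt0.
pose A := amalg_sub (sub_incl X Z) (sub_incl X Z).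
pose x (i : I) := Linf_xlog (walsh_sum s_steinhaus U i).
pose q (i : I) : cquot A := cquot_pi A (x i, - x i).
have qmin : mnorm (min_opspace (cquot A)) (column j0 q) <= 2.
  apply: min_column_le => a a1.
  have [z zZ hz] := xlog_comb_near s_steinhaus h n_gt0 a1.
  have -> : \sum_i a i *: q i =
      cquot_pi A (\sum_i a i *: x i, - \sum_i a i *: x i).
    rewrite (_ : (_, _) = \sum_i a i *: ((x i, - x i) : (Linf P * Linf P)%type)).
      by rewrite linear_sum; apply: eq_bigr => i _; rewrite linearZ.
    rewrite [RHS]surjective_pairing; congr pair; rewrite [RHS]raddf_sum//=.
    by rewrite -sumrN; apply: eq_bigr => i _; rewrite scalerN.
  by apply: le_trans hz; exact: amalg_antidiag_le.
have qM : mnorm (amalg_sum (sub_incl X Z) (sub_incl X Z)) (column j0 q) < M.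
  apply: le_lt_trans (hM0 _ _) _; rewrite /M.
  apply: (@le_lt_trans _ _ (Num.max M0 0 * 2)); last by rewrite ltrDl.
  apply: (@le_trans _ _ (Num.max M0 0 * mnorm (min_opspace (cquot A)) (column j0 q))).
    by rewrite ler_wpM2r ?mnorm_ge0// le_max lexx.
  by rewrite ler_wpM2l// le_max lexx orbT.
rewrite -subr_gt0 in qM.
(* The slack is the gap between [M] and the quotient norm, so the lift [u] has norm below [M]. *)
have [u uq uM] := infnorm_lt (@cquot_mx_surj _ _ A #|I|)
  (@mnorm_ge0 _ _ (dsum_opspace X X) #|I|) (column j0 q) qM.
rewrite addrC subrK in uM.
pose p (i : I) := (u (enum_rank i) j0).1.
have p_near i : p i - x i \in Z.
  apply: (@amalg_sub_fst _ _ X Z (u (enum_rank i) j0 - (x i, - x i))).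
  apply/(lquot_eq A); have /matrixP/(_ (enum_rank i) j0) := uq.
  by rewrite !mxE eqxx enum_rankK.
have p_le (a : I -> R[i]) : \sum_i normc (a i) ^+ 2 <= 1 ->
    rnorm (\sum_i a i *: p i) <= M.
  move=> a1; have := mnorm_column_ge j0 X (map_mx fst u) a1.
  under eq_bigr do rewrite mxE; move=> /le_trans; apply.
  by apply: le_trans (ltW uM); rewrite /= le_max lexx.
have := lift_lower s_indep h n_gt0 p_near p_le r0 r1 rn.
rewrite r2 lnV ?posrE ?exprn_gt0// lnXn ?ltr0n// -[ln 2 *+ m]mulr_natl.
move: hm; lra.
Qed.
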